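(* Let $R$ be a commutative algebra. Denote by $\mathrm{Br}_{\mathrm{Gal}}(R)$ the subset of the Brauer group $\mathrm{Br}(R)$ consisting of those classes $\xi\in\mathrm{Br}(R)$ for which there exist a finite group $G$ and a $G$-Galois-Azumaya extension $\psi:R\to S$ such that $\xi=[S]$. Then $\mathrm{Br}_{\mathrm{Gal}}(R)$ is a subgroup of $\mathrm{Br}(R)$.
   Context: Fix a commutative ring $k$; ''algebra'' means associative unital $k$-algebra. $\mathrm{Br}(R)$ is the Brauer group of the commutative ring $R$, consisting of classes $[S]$ of Azumaya $R$-algebras modulo stable isomorphism (Brauer equivalence: $S\sim S'$ iff $S\otimes_R\mathrm{End}_R(P)\cong S'\otimes_R\mathrm{End}_R(P')$ for some finitely generated projective faithful $R$-modules $P,P'$), with product induced by $\otimes_R$. If a finite group $G$ acts by ring automorphisms on an algebra $S$, let $S(G)$ be the algebra of all maps $G\to S$ with pointwise operations, a free left $S$-module with basis the Dirac functions $\delta_g$ ($g\in G$). A $G$-Galois extension is a morphism of algebras $\psi:R\to S$ together with a finite group $G$ acting by ring automorphisms on $S$, trivially on $\psi(R)$, such that $S$ is faithfully flat as a left $R$-module and $\Gamma:S\otimes_RS\to S(G)$, $\Gamma(s\otimes t)=\sum_{g\in G}s\,g(t)\,\delta_g$, is an isomorphism. It is $G$-Galois-Azumaya if moreover $R$ is commutative and $S$ is an Azumaya (i.e. central separable) $R$-algebra. *)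

(* Defs.v *)
From HB Require Import structures.
From mathcomp Require Import all_boot all_algebra all_fingroup.
From mathcomp Require Import boolp.

Set Implicit Arguments.
Unset Strict Implicit.
Unset Printing Implicit Defensive.

Import GRing.Theory.
Local Open Scope ring_scope.

(* An algebra over a commutative ring R is a ring with a ring morphism from R
   to its center. MathComp's algType is not used because it requires 1 != 0:
   the base ring, or a tensor product of nonzero algebras, may be zero. *)
HB.mixin Record isRAlgebra (R : comPzRingType) A of GRing.PzRing A := {
  alg_map : {rmorphism R -> A};
  alg_mapC : forall (r : R) (x : A), alg_map r * x = x * alg_map r
}.

#[short(type="ralgType")]
HB.structure Definition RAlgebra (R : comPzRingType) :=
  { A of GRing.PzRing A & isRAlgebra R A }.

#[short(type="comRalgType")]
HB.structure Definition ComRAlgebra (R : comPzRingType) :=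
  { A of GRing.ComPzRing A & RAlgebra R A }.

Definition rmorph_of (A B : pzRingType) (f : A -> B)
    (fB : zmod_morphism f) (fM : monoid_morphism f) : {rmorphism A -> B} :=
  HB.pack f (GRing.isZmodMorphism.Build A B f fB)
    (GRing.isMonoidMorphism.Build A B f fM).

(* The R-module underlying an R-algebra. *)
Section UnderlyingModule.
Variables (R : comPzRingType) (S : ralgType R).

Definition amod : Type := S.
HB.instance Definition _ := RAlgebra.on amod.

Definition amod_scale (r : R) (x : amod) : amod := alg_map r * x.

Let scA a b x : amod_scale a (amod_scale b x) = amod_scale (a * b) x.
Proof. by rewrite /amod_scale rmorphM mulrA. Qed.
Let sc1 : left_id 1 amod_scale.
Proof. by move=> x; rewrite /amod_scale rmorph1 mul1r. Qed.
Let scDr : right_distributive amod_scale +%R.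
Proof. by move=> r x y; exact: mulrDr. Qed.
Let scDl x : {morph amod_scale^~ x : a b / a + b}.
Proof. by move=> a b; rewrite /amod_scale rmorphD mulrDl. Qed.
HB.instance Definition _ :=
  GRing.Zmodule_isLmodule.Build R amod scA sc1 scDr scDl.

Lemma amodZE (r : R) (x : amod) : r *: x = alg_map r * x. Proof. by []. Qed.
Lemma amodAl (r : R) (x y : amod) : r *: (x * y) = (r *: x) * y.
Proof. exact: mulrA. Qed.
Lemma amodAr (r : R) (x y : amod) : r *: (x * y) = x * (r *: y).
Proof. by rewrite !amodZE !mulrA alg_mapC. Qed.
End UnderlyingModule.

Section RegularAlgebra.
Variable R : comPzRingType.
Let regC (r : R) (x : R^o) : (idfun : {rmorphism R -> R}) r * x = x * r.
Proof. exact: mulrC. Qed.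
HB.instance Definition _ :=
  isRAlgebra.Build R R^o (alg_map := (idfun : {rmorphism R -> R})) regC.
End RegularAlgebra.

Section OppositeAlgebra.
Variables (R : comPzRingType) (S : ralgType R).

Let oppB : zmod_morphism (fun r : R => alg_map r : S^c).
Proof. exact: (rmorphB (alg_map : {rmorphism R -> S})). Qed.
Let oppM : monoid_morphism (fun r : R => alg_map r : S^c).
Proof.
split=> [|a b]; first exact: (rmorph1 (alg_map : {rmorphism R -> S})).
by rewrite mulrC; exact: (rmorphM (alg_map : {rmorphism R -> S})).
Qed.
Let oppC (r : R) (x : S^c) : rmorph_of oppB oppM r * x = x * rmorph_of oppB oppM r.
Proof. exact/esym/(@alg_mapC R S). Qed.
HB.instance Definition _ := isRAlgebra.Build R S^c oppC.
End OppositeAlgebra.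

Section Modules.
Variables (A : pzRingType) (P : lmodType A).

Definition finitely_generated :=
  exists (n : nat) (p : 'I_n -> P),
    forall x, exists c : 'I_n -> A, x = \sum_i c i *: p i.

Definition projective :=
  forall (M N : lmodType A) (q : {linear M -> N}) (f : {linear P -> N}),
    (forall y, exists x, q x = y) ->
    exists g : {linear P -> M}, forall x, q (g x) = f x.

Definition faithful := forall a : A, (forall x : P, a *: x = 0) -> a = 0.
End Modules.

Definition exact_pair (A : pzRingType) (L M N : lmodType A)
    (f : L -> M) (g : M -> N) :=
  forall y, (g y = 0) <-> (exists x, f x = y).

Section Endomorphisms.
Variables (R : comPzRingType) (P : lmodType R).

Definition endo := {linear P -> P}.
HB.instance Definition _ := gen_eqMixin endo.
HB.instance Definition _ := gen_choiceMixin endo.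

Implicit Types f g h : endo.

Lemma endoP f g : (forall x, f x = g x) -> f = g.
Proof.
case: f g => [f [[mf] [sf]]] [g [[mg] [sg]]] /= /funext fg.
subst g; by rewrite (Prop_irrelevance mf mg) (Prop_irrelevance sf sg).
Qed.

Let addL f g : linear (fun x => f x + g x).
Proof. by move=> r x y; rewrite !linearP scalerDr addrACA. Qed.
Let oppL f : linear (fun x => - f x).
Proof. by move=> r x y; rewrite linearP opprD scalerN. Qed.
Let zeroL : linear (fun _ : P => 0 : P).
Proof. by move=> r x y; rewrite scaler0 addr0. Qed.
Let scaleL (r : R) f : linear (fun x => r *: f x).
Proof. by move=> s x y; rewrite linearP scalerDr !scalerA mulrC. Qed.
Let compL f g : linear (fun x => f (g x)).
Proof. by move=> s x y; rewrite !linearP. Qed.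
Let idL : linear (fun x : P => x).
Proof. by []. Qed.

Let pack (f : P -> P) (fL : linear f) : endo :=
  HB.pack f (GRing.isLinear.Build R P P *:%R f fL).

Definition endo_add f g := pack (addL f g).
Definition endo_opp f := pack (oppL f).
Definition endo_zero := pack zeroL.
Definition endo_scale r f := pack (scaleL r f).
Definition endo_mul f g := pack (compL f g).
Definition endo_one := pack idL.

Let addA : associative endo_add.
Proof. by move=> f g h; apply: endoP => x; apply: addrA. Qed.
Let addC : commutative endo_add.
Proof. by move=> f g; apply: endoP => x; apply: addrC. Qed.
Let add0 : left_id endo_zero endo_add.
Proof. by move=> f; apply: endoP => x; apply: add0r. Qed.
Let addN : left_inverse endo_zero endo_opp endo_add.
Proof. by move=> f; apply: endoP => x; apply: addNr. Qed.
HB.instance Definition _ := GRing.isZmodule.Build endo addA addC add0 addN.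

Let mulA : associative endo_mul.
Proof. by move=> f g h; apply: endoP. Qed.
Let mul1 : left_id endo_one endo_mul.
Proof. by move=> f; apply: endoP. Qed.
Let mulr1 : right_id endo_one endo_mul.
Proof. by move=> f; apply: endoP. Qed.
Let mulDl : left_distributive endo_mul +%R.
Proof. by move=> f g h; apply: endoP. Qed.
Let mulDr : right_distributive endo_mul +%R.
Proof. by move=> f g h; apply: endoP => x; apply: linearD. Qed.
HB.instance Definition _ :=
  GRing.Zmodule_isPzRing.Build endo mulA mul1 mulr1 mulDl mulDr.

Let scA a b f : endo_scale a (endo_scale b f) = endo_scale (a * b) f.
Proof. by apply: endoP => x; apply: scalerA. Qed.
Let sc1 : left_id 1 endo_scale.
Proof. by move=> f; apply: endoP => x; apply: scale1r. Qed.
Let scDr : right_distributive endo_scale +%R.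
Proof. by move=> r f g; apply: endoP => x; apply: scalerDr. Qed.
Let scDl f : {morph endo_scale^~ f : a b / a + b}.
Proof. by move=> a b; apply: endoP => x; apply: scalerDl. Qed.
HB.instance Definition _ :=
  GRing.Zmodule_isLmodule.Build R endo scA sc1 scDr scDl.

Let algB : zmod_morphism (fun r : R => r *: (1 : endo)).
Proof. by move=> a b; rewrite scalerBl. Qed.
Let algM : monoid_morphism (fun r : R => r *: (1 : endo)).
Proof.
split=> [|a b]; first by rewrite scale1r.
by apply: endoP => x; rewrite /= -scalerA.
Qed.
Let algC (r : R) (f : endo) : rmorph_of algB algM r * f = f * rmorph_of algB algM r.
Proof. by apply: endoP => x; rewrite /= linearZ. Qed.
HB.instance Definition _ := isRAlgebra.Build R endo algC.
End Endomorphisms.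

Section TensorProduct.
Variables (R : comPzRingType) (M N : lmodType R).
Local Open Scope quotient_scope.

(* The list [:: (x1, y1); ...; (xn, yn)] stands for the sum of the xi (x) yi. *)
Inductive tens_eq : seq (M * N) -> seq (M * N) -> Prop :=
| TensRefl u : tens_eq u u
| TensSym u v : tens_eq u v -> tens_eq v u
| TensTrans u v w : tens_eq u v -> tens_eq v w -> tens_eq u w
| TensCat u u' v v' :
    tens_eq u u' -> tens_eq v v' -> tens_eq (u ++ v) (u' ++ v')
| TensC u v : tens_eq (u ++ v) (v ++ u)
| Tens0 y : tens_eq [:: (0, y)] [::]
| TensDl x x' y : tens_eq [:: (x + x', y)] [:: (x, y); (x', y)]
| TensDr x y y' : tens_eq [:: (x, y + y')] [:: (x, y); (x, y')]
| TensZ r x y : tens_eq [:: (r *: x, y)] [:: (x, r *: y)].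

Definition tens_rel : rel (seq (M * N)) := fun u v => `[< tens_eq u v >].

Let tens_rel_refl : reflexive tens_rel.
Proof. by move=> u; apply/asboolP; exact: TensRefl. Qed.
Let tens_rel_sym : symmetric tens_rel.
Proof. by move=> u v; apply/asboolP/asboolP; apply: TensSym. Qed.
Let tens_rel_trans : transitive tens_rel.
Proof.
by move=> v u w /asboolP uv /asboolP vw; apply/asboolP; apply: TensTrans vw.
Qed.
Canonical tens_equiv :=
  EquivRel tens_rel tens_rel_refl tens_rel_sym tens_rel_trans.

Definition tens := {eq_quot tens_equiv}.
HB.instance Definition _ := Choice.on tens.

Definition tcls (u : seq (M * N)) : tens := \pi_tens u.
Definition trep (t : tens) : seq (M * N) := generic_quotient.repr t.

Lemma tclsP u v : tens_eq u v <-> tcls u = tcls v.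
Proof.
split=> [uv|/eqmodP/asboolP //]; by apply/eqmodP/asboolP.
Qed.

Lemma trepK : cancel trep tcls. Proof. exact: reprK. Qed.

Lemma trep_cls u : tens_eq (trep (tcls u)) u.
Proof. by apply/tclsP; rewrite trepK. Qed.

Definition tpure x y := tcls [:: (x, y)].
Definition tens_zero := tcls [::].
Definition tens_add s t := tcls (trep s ++ trep t).
Definition raw_scale (r : R) := map (fun p : M * N => (r *: p.1, p.2)).
Definition tens_scale r t := tcls (raw_scale r (trep t)).
Definition tens_opp t := tens_scale (- 1) t.

Lemma tens_addE u v : tens_add (tcls u) (tcls v) = tcls (u ++ v).
Proof. by apply/tclsP; apply: TensCat; exact: trep_cls. Qed.

Lemma raw_scale_eq r u v :
  tens_eq u v -> tens_eq (raw_scale r u) (raw_scale r v).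
Proof.
elim=> {u v} /=.
- by move=> u; exact: TensRefl.
- by move=> u v _; exact: TensSym.
- by move=> u v w _ uv _; exact: TensTrans.
- by move=> u u' v v' _ uu' _ vv'; rewrite /raw_scale !map_cat; exact: TensCat.
- by move=> u v; rewrite /raw_scale !map_cat; exact: TensC.
- by move=> y; rewrite scaler0; exact: Tens0.
- by move=> x x' y; rewrite scalerDr; exact: TensDl.
- by move=> x y y'; exact: TensDr.
- by move=> s x y; rewrite scalerA mulrC -scalerA; exact: TensZ.
Qed.

Lemma tens_scaleE r u : tens_scale r (tcls u) = tcls (raw_scale r u).
Proof. by apply/tclsP; apply/raw_scale_eq/trep_cls. Qed.

Lemma tensW (P : tens -> Prop) : (forall u, P (tcls u)) -> forall t, P t.
Proof. by move=> Pu t; rewrite -[t]trepK. Qed.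

Let addA : associative tens_add.
Proof.
by elim/tensW=> u; elim/tensW=> v; elim/tensW=> w; rewrite !tens_addE catA.
Qed.
Let addC : commutative tens_add.
Proof.
by elim/tensW=> u; elim/tensW=> v; rewrite !tens_addE; apply/tclsP/TensC.
Qed.
Let add0 : left_id tens_zero tens_add.
Proof. by elim/tensW=> u; rewrite tens_addE. Qed.

Let scDl t : {morph tens_scale^~ t : a b / a + b >-> tens_add a b}.
Proof.
move=> a b; elim/tensW: t => u; rewrite !tens_scaleE tens_addE; apply/tclsP.
elim: u => [|[x y] u IHu] /=; first exact: TensRefl.
rewrite scalerDl -cat1s.
apply: TensTrans (TensCat (TensDl _ _ _) IHu) _.
set p := (a *: x, y); set q := (b *: x, y).
set ra := raw_scale a u; set rb := raw_scale b u.
have -> : p :: ra ++ q :: rb = [:: p] ++ (ra ++ [:: q]) ++ rb.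
  by rewrite /= -catA.
apply: (@TensCat [:: p] _ (([:: q] ++ ra) ++ rb)); first exact: TensRefl.
by apply: TensCat; [exact: TensC|exact: TensRefl].
Qed.
Let sc0 t : tens_scale 0 t = tens_zero.
Proof.
elim/tensW: t => u; rewrite tens_scaleE; apply/tclsP.
elim: u => [|[x y] u IHu] /=; first exact: TensRefl.
by rewrite scale0r -cat1s -(cat0s [::]); apply: TensCat => //; exact: Tens0.
Qed.
Let sc1 : left_id 1 tens_scale.
Proof.
elim/tensW=> u; rewrite tens_scaleE /raw_scale (eq_map (g := id)) ?map_id //.
by case=> x y /=; rewrite scale1r.
Qed.
Let addN : left_inverse tens_zero tens_opp tens_add.
Proof. by move=> t; rewrite -{2}[t]sc1 -scDl addNr sc0. Qed.
HB.instance Definition _ := GRing.isZmodule.Build tens addA addC add0 addN.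

Let scA a b t : tens_scale a (tens_scale b t) = tens_scale (a * b) t.
Proof.
elim/tensW: t => u; rewrite !tens_scaleE /raw_scale -map_comp.
by congr tcls; apply: eq_map => -[x y] /=; rewrite scalerA.
Qed.
Let scDr : right_distributive tens_scale +%R.
Proof.
move=> r; elim/tensW=> u; elim/tensW=> v.
by rewrite [_ + _]tens_addE !tens_scaleE [RHS]tens_addE /raw_scale map_cat.
Qed.
HB.instance Definition _ :=
  GRing.Zmodule_isLmodule.Build R tens scA sc1 scDr scDl.

Lemma tclsE u : tcls u = \sum_(p <- u) tpure p.1 p.2.
Proof.
elim: u => [|[x y] u IHu]; first by rewrite big_nil.
by rewrite big_cons -IHu /= [RHS]tens_addE.
Qed.

Lemma tens_ind (P : tens -> Prop) :
    P 0 -> (forall s t, P s -> P t -> P (s + t)) ->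
    (forall x y, P (tpure x y)) -> forall t, P t.
Proof.
move=> P0 PD Pp; elim/tensW=> u; rewrite tclsE.
by elim/big_ind: _ => // -[x y] _; exact: Pp.
Qed.

Lemma tpureDl x x' y : tpure (x + x') y = tpure x y + tpure x' y.
Proof. by rewrite [RHS]tens_addE; apply/tclsP/TensDl. Qed.
Lemma tpureDr x y y' : tpure x (y + y') = tpure x y + tpure x y'.
Proof. by rewrite [RHS]tens_addE; apply/tclsP/TensDr. Qed.
Lemma tpureZl r x y : tpure (r *: x) y = r *: tpure x y.
Proof. by rewrite [RHS]tens_scaleE. Qed.
Lemma tpureZr r x y : tpure x (r *: y) = r *: tpure x y.
Proof. by rewrite -tpureZl; apply/esym/tclsP/TensZ. Qed.

Definition bilin (W : lmodType R) (f : M -> N -> W) :=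
  (forall y, linear (f^~ y)) /\ (forall x, linear (f x)).

Lemma tpure_bilin : bilin tpure.
Proof.
split=> [y r x x'|x r y y']; first by rewrite tpureDl tpureZl.
by rewrite tpureDr tpureZr.
Qed.

(* The linear map induced by a bilinear map f; it is meaningful, i.e.
   independent of the chosen representatives, only for bilinear f. *)
Definition tlift (W : lmodType R) (f : M -> N -> W) (t : tens) : W :=
  \sum_(p <- trep t) f p.1 p.2.

Section Lift.
Variables (W : lmodType R) (f : M -> N -> W).
Hypothesis fB : bilin f.

Lemma tlift_cls u : tlift f (tcls u) = \sum_(p <- u) f p.1 p.2.
Proof.
have [fl fr] := fB.
have f0 y : f 0 y = 0.
  have := fl y (- 1) 0 0; rewrite scaler0 addr0 => ->.
  by rewrite scaleN1r addNr.
have fZl r x y : f (r *: x) y = r *: f x y.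
  by have := fl y r x 0; rewrite addr0 f0 addr0.
have fr0 x : f x 0 = 0.
  have := fr x (- 1) 0 0; rewrite scaler0 addr0 => ->.
  by rewrite scaleN1r addNr.
have fZr r x y : f x (r *: y) = r *: f x y.
  by have := fr x r y 0; rewrite addr0 fr0 addr0.
have fDl x x' y : f (x + x') y = f x y + f x' y.
  by have := fl y 1 x x'; rewrite !scale1r.
have fDr x y y' : f x (y + y') = f x y + f x y'.
  by have := fr x 1 y y'; rewrite !scale1r.
suff sumE v w : tens_eq v w -> \sum_(p <- v) f p.1 p.2 = \sum_(p <- w) f p.1 p.2.
  exact/sumE/trep_cls.
elim=> {u v w} //=.
- by move=> u v w _ -> _ ->.
- by move=> u u' v v' _ uu' _ vv'; rewrite !big_cat uu' vv'.
- by move=> u v; rewrite !big_cat /= addrC.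
- by move=> y; rewrite big_seq1 big_nil.
- by move=> x x' y; rewrite !(big_cons, big_nil) !addr0 fDl.
- by move=> x y y'; rewrite !(big_cons, big_nil) !addr0 fDr.
- by move=> r x y; rewrite !big_seq1 fZl fZr.
Qed.

Lemma tlift_pure x y : tlift f (tpure x y) = f x y.
Proof. by rewrite tlift_cls big_seq1. Qed.

Lemma tlift_linear : linear (tlift f).
Proof.
have [fl _] := fB.
move=> r; elim/tensW=> u; elim/tensW=> v.
rewrite [r *: _]tens_scaleE [_ + _]tens_addE !tlift_cls big_cat big_map /=.
rewrite scaler_sumr; congr (_ + _); apply: eq_bigr => -[x y] _ /=.
have := fl y r x 0; rewrite addr0 => ->.
have := fl y (- 1) 0 0; rewrite scaler0 addr0 => ->.
by rewrite scaleN1r addNr addr0.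
Qed.
End Lift.
End TensorProduct.

Notation "x \ox y" := (tpure x y) (at level 40, left associativity).

Section TensorMap.
Variables (R : comPzRingType) (M M' N : lmodType R) (f : {linear M -> M'}).

Definition tmapl : tens M N -> tens M' N := tlift (fun x y => f x \ox y).

Lemma tmapl_bilin : bilin (fun (x : M) (y : N) => f x \ox y).
Proof.
split=> [y r x x'|x r y y']; first by rewrite linearP tpureDl tpureZl.
by rewrite tpureDr tpureZr.
Qed.
End TensorMap.

Section TensorAlgebra.
Variables (R : comPzRingType) (S T : ralgType R).

Definition atens := tens (amod S) (amod T).
Local Notation ST := atens.
HB.instance Definition _ := GRing.Lmodule.on ST.

Definition tens_mul (u v : ST) : ST :=
  tlift (fun (s : amod S) (t : amod T) =>
    tlift (fun (s' : amod S) (t' : amod T) => (s * s') \ox (t * t') : ST) v) u.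
Definition tens_one : ST := (1 : amod S) \ox (1 : amod T).

Let inner_bilin (s : amod S) (t : amod T) :
  bilin (fun (s' : amod S) (t' : amod T) => (s * s') \ox (t * t') : ST).
Proof.
split=> [t' r s1 s2|s' r t1 t2].
  by rewrite mulrDr -amodAr tpureDl tpureZl.
by rewrite mulrDr -amodAr tpureDr tpureZr.
Qed.

Let outer_bilin (v : ST) :
  bilin (fun (s : amod S) (t : amod T) => tlift (fun (s' : amod S) (t' : amod T) => (s * s') \ox (t * t') : ST) v).
Proof.
split=> [t r s1 s2|s r t1 t2]; rewrite /tlift scaler_sumr -big_split /=;
  apply: eq_bigr => p _; rewrite mulrDl -amodAl.
  by rewrite tpureDl tpureZl.
by rewrite tpureDr tpureZr.
Qed.

Lemma tens_mulE s t s' t' :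
  tens_mul (s \ox t) (s' \ox t') = (s * s') \ox (t * t').
Proof.
by rewrite /tens_mul (tlift_pure (outer_bilin _)) (tlift_pure (inner_bilin _ _)).
Qed.

Let mul_linl v : linear (tens_mul^~ v).
Proof. exact: tlift_linear (outer_bilin v). Qed.
Let mul_linr u : linear (tens_mul u).
Proof.
move=> r v w; rewrite /tens_mul {1 3 5}/tlift scaler_sumr -big_split /=.
by apply: eq_bigr => p _; rewrite (tlift_linear (inner_bilin _ _)).
Qed.

Let mulDl : left_distributive tens_mul +%R.
Proof. by move=> u v w; have := mul_linl w 1 u v; rewrite !scale1r. Qed.
Let mulDr : right_distributive tens_mul +%R.
Proof. by move=> u v w; have := mul_linr u 1 v w; rewrite !scale1r. Qed.
Let mul0 v : tens_mul 0 v = 0.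
Proof. by apply: (addrI (tens_mul 0 v)); rewrite -mulDl !addr0. Qed.
Let mulr0 v : tens_mul v 0 = 0.
Proof. by apply: (addrI (tens_mul v 0)); rewrite -mulDr !addr0. Qed.

Let mulA : associative tens_mul.
Proof.
move=> u v w.
elim/tens_ind: u => [|u u' IH IH'|s1 t1]; first by rewrite !mul0.
  by rewrite !mulDl IH IH'.
elim/tens_ind: v => [|v v' IH IH'|s2 t2]; first by rewrite !(mul0, mulr0).
  by rewrite !(mulDl, mulDr) IH IH'.
elim/tens_ind: w => [|w w' IH IH'|s3 t3]; first by rewrite !mulr0.
  by rewrite !mulDr IH IH'.
by rewrite !tens_mulE !mulrA.
Qed.
Let mul1 : left_id tens_one tens_mul.
Proof.
elim/tens_ind=> [|u v IH IH'|s t]; first exact: mulr0.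
  by rewrite mulDr IH IH'.
by rewrite tens_mulE !mul1r.
Qed.
Let mulr1 : right_id tens_one tens_mul.
Proof.
elim/tens_ind=> [|u v IH IH'|s t]; first exact: mul0.
  by rewrite mulDl IH IH'.
by rewrite tens_mulE !GRing.mulr1.
Qed.
HB.instance Definition _ :=
  GRing.Zmodule_isPzRing.Build ST mulA mul1 mulr1 mulDl mulDr.

Let algB : zmod_morphism (fun r : R => r *: (1 : ST)).
Proof. by move=> a b; rewrite scalerBl. Qed.
Let algC0 (r : R) (u : ST) : (r *: (1 : ST)) * u = r *: u.
Proof.
have := mul_linl u r tens_one 0.
by rewrite /= !addr0 mul0 addr0 mul1.
Qed.
Let algC1 (r : R) (u : ST) : u * (r *: (1 : ST)) = r *: u.
Proof.
have := mul_linr u r tens_one 0.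
by rewrite /= !addr0 mulr0 addr0 mulr1.
Qed.
Let algM : monoid_morphism (fun r : R => r *: (1 : ST)).
Proof. by split=> [|a b]; rewrite ?scale1r // algC0 scalerA. Qed.
Let algC (r : R) (u : ST) : rmorph_of algB algM r * u = u * rmorph_of algB algM r.
Proof. exact: etrans (algC0 r u) (esym (algC1 r u)). Qed.
HB.instance Definition _ := isRAlgebra.Build R ST algC.

Lemma tpureM (s s' : amod S) (t t' : amod T) :
  (s \ox t : ST) * (s' \ox t' : ST) = (s * s') \ox (t * t').
Proof. exact: tens_mulE. Qed.
End TensorAlgebra.

Section EnvelopingAlgebra.
Variables (R : comPzRingType) (S : ralgType R).

Definition enveloping := atens S S^c.
HB.instance Definition _ := RAlgebra.on enveloping.

(* S as a left module over its enveloping algebra: (s (x) t) x = s x t. *)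
Definition bimod : Type := S.
HB.instance Definition _ := GRing.Zmodule.on bimod.

Definition env_scale (u : enveloping) (x : bimod) : bimod :=
  tlift (fun (s : amod S) (t : amod S^c) => s * x * t : amod S) u.

Let env_bilin (x : S) :
  bilin (fun (s : amod S) (t : amod S^c) => s * x * t : amod S).
Proof.
split=> [t r s1 s2|s r t1 t2].
  by rewrite !mulrDl -!amodAl.
rewrite [LHS]mulrDr; congr (_ + _).
change ((s : S) * x * ((t1 : S) * alg_map r) = alg_map r * ((s : S) * x * t1)).
by rewrite alg_mapC mulrA.
Qed.

Lemma env_scale_pure (s : amod S) (t : amod S^c) (x : S) :
  env_scale (s \ox t) x = s * x * (t : S).
Proof. exact: tlift_pure (env_bilin x) s t. Qed.

Let scDl x : {morph env_scale^~ x : u v / u + v}.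
Proof.
by move=> u v; have := tlift_linear (env_bilin x) 1 u v; rewrite !scale1r.
Qed.
Let scDr : right_distributive env_scale +%R.
Proof.
move=> u x y; rewrite /env_scale /tlift -big_split /=.
by apply: eq_bigr => p _; rewrite mulrDr mulrDl.
Qed.
Let sc1 : left_id 1 env_scale.
Proof. by move=> x; rewrite [LHS]env_scale_pure mul1r mulr1. Qed.
Let sc0 x : env_scale 0 x = 0.
Proof. by apply: (addrI (env_scale 0 x)); rewrite -scDl !addr0. Qed.
Let scr0 u : env_scale u 0 = 0.
Proof. by apply: (addrI (env_scale u 0)); rewrite -scDr !addr0. Qed.
Let scA u v x : env_scale u (env_scale v x) = env_scale (u * v) x.
Proof.
elim/tens_ind: u => [|u u' IH IH'|s t]; first by rewrite mul0r !sc0.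
  by rewrite scDl IH IH' mulrDl scDl.
elim/tens_ind: v => [|v v' IH IH'|s' t']; first by rewrite mulr0 !sc0 scr0.
  by rewrite scDl scDr IH IH' mulrDr scDl.
by rewrite [_ * _]tpureM !env_scale_pure !mulrA.
Qed.
HB.instance Definition _ :=
  GRing.Zmodule_isLmodule.Build enveloping bimod scA sc1 scDr scDl.
End EnvelopingAlgebra.

Section Brauer.
Variable R : comPzRingType.
Implicit Types S T U : ralgType R.

Definition central S :=
  injective (fun r : R => alg_map r : S) /\
  (forall z : S, (forall s : S, z * s = s * z) -> exists r : R, z = alg_map r).

Definition separable S := @projective (enveloping S) (bimod S).

Definition azumaya S := central S /\ separable S.

Definition alg_iso S T :=
  exists f : {rmorphism S -> T},
    bijective f /\ (forall r : R, f (alg_map r) = alg_map r).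

Definition brauer_equiv S T :=
  exists P Q : lmodType R,
    [/\ [/\ finitely_generated P, projective P & faithful P],
        [/\ finitely_generated Q, projective Q & faithful Q] &
        alg_iso (atens S (endo P)) (atens T (endo Q))].

(* Elements of the Brauer group are represented as the classes themselves,
   i.e. as predicates on R-algebras. *)
Definition brauer_class S : ralgType R -> Prop :=
  fun T => azumaya T /\ brauer_equiv S T.

Implicit Types xi eta : ralgType R -> Prop.

Definition Br xi := exists S, azumaya S /\ xi = brauer_class S.

Definition br_one := brauer_class R^o.

(* The class of S (x) T for any representatives S of xi and T of eta. *)
Definition br_mul xi eta : ralgType R -> Prop :=
  fun U => azumaya U /\
    exists S T, [/\ xi S, eta T & brauer_equiv (atens S T) U].

Definition br_subgroup (H : (ralgType R -> Prop) -> Prop) :=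
  [/\ forall xi, H xi -> Br xi,
      H br_one,
      forall xi eta, H xi -> H eta -> H (br_mul xi eta) &
      forall xi, H xi ->
        exists eta, [/\ H eta, br_mul xi eta = br_one
                      & br_mul eta xi = br_one]].
End Brauer.

Section Galois.
Variable R : comPzRingType.

Definition faithfully_flat (M : lmodType R) :=
  forall (N1 N2 N3 : lmodType R) (f : {linear N1 -> N2}) (g : {linear N2 -> N3}),
    exact_pair f g <-> exact_pair (tmapl (N := M) f) (tmapl (N := M) g).

Variables (S : ralgType R) (G : finGroupType) (act : G -> {rmorphism S -> S}).

Definition galois_action :=
  [/\ forall s, act 1%g s = s,
      forall g h s, act (g * h)%g s = act g (act h s) &
      forall g (r : R), act g (alg_map r) = alg_map r].

Definition galois_map (u : atens S S) : {ffun G -> S} :=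
  [ffun g => tlift (fun s t : amod S => s * act g t : amod S) u].

Lemma galois_map_pure (s t : amod S) (g : G) :
  galois_action -> galois_map (s \ox t) g = s * act g t.
Proof.
move=> [_ _ actR]; rewrite ffunE tlift_pure //.
have actZ r (x : amod S) : act g (r *: x) = r *: (act g x : amod S).
  by rewrite !amodZE rmorphM actR.
split=> [y r x x'|x r y y'].
  by rewrite mulrDl -amodAl.
by rewrite rmorphD actZ mulrDr -amodAr.
Qed.

Definition galois_extension :=
  [/\ galois_action, faithfully_flat (amod S) & bijective galois_map].
End Galois.

Definition galois_azumaya (R : comPzRingType) (S : ralgType R)
    (G : finGroupType) (act : G -> {rmorphism S -> S}) :=
  galois_extension act /\ azumaya S.

Definition BrGal (R : comPzRingType) (xi : ralgType R -> Prop) :=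
  Br xi /\
  exists (G : finGroupType) (S : ralgType R) (act : G -> {rmorphism S -> S}),
    galois_azumaya act /\ xi = brauer_class S.

(* Main.v *)
From HB Require Import structures.
From mathcomp Require Import all_boot all_algebra all_fingroup.
From mathcomp Require Import boolp.
Require Import Defs.

(** A Galois extension with center R is controlled by Galois coordinates: finite
    families a_i, b_i in S with sum_i a_i g(b_i) = 1 if g = 1 and 0 otherwise
    (the element e = sum_i a_i (x) b_i is the preimage of the Dirac function at
    1 under the Galois map).  Since the Galois map is injective, e is also a
    Casimir element: x e = e x for the outer bimodule structure of S (x) S.
    Hence s |-> sum_i a_i s b_i takes its values in the center R and fixes 1:
    it retracts S onto R, and the traces tr(s) = sum_g g(s), being invariant, lie
    in R (galois_extension_coords).  Conversely, the equations above, the Casimir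
    property and the inclusion of the traces in R make the Galois map bijective
    (coords_galois_bij), and if S has center R, it also yields the
    rest of the definition: e is a separability idempotent, the forms
    x |-> tr(b_i x) are dual to the a_i, and a module with a finite dual basis
    and a retraction onto R is faithfully flat (coords_galois_azumaya).

    Galois coordinates can be transported.  Those of S (x)_R T, for G x H, are
    the products of those of S and T; those of the opposite algebra, for the
    same group, are (b_i), (a_i); the algebra R has the coordinates 1, 1 for the
    trivial group.  The center of S (x) T is R, because a central element is its
    own sandwich and the sandwiches are scalars (tens_central).  So products, opposites and the unit
    are represented by Galois-Azumaya extensions.

    It remains to see that the opposite algebra represents the inverse class,
    that is, S (x) S^op is isomorphic to End_R(S).  A classical argument for
    Azumaya algebras localizes at maximal ideals; here there is an explicit
    inverse.  As e is invariant under G acting on both factors, the sandwich map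
    does not distinguish s from g(s), whence tr(s) = |G| sum_i a_i s b_i
    (trace_sandwich).  An endomorphism phi sends x = sum_j a_j tr(b_j x) to
    sum_j phi(a_j) tr(b_j x) = |G| sum_ij phi(a_j) a_i b_j x b_i, which is the
    action of an element of S (x) S^op (coords_enveloping_endo).

    The group law on classes needs Brauer equivalence to be an equivalence
    relation compatible with tensor products.  Both follow from the isomorphism
    End(P) (x) End(Q) = End(P (x) Q) for finitely generated projective modules,
    proved with dual bases (endo_tens). *)

Set Implicit Arguments.
Unset Strict Implicit.
Unset Printing Implicit Defensive.

Import GRing.Theory.
Local Open Scope ring_scope.

Definition linear_of (A : pzRingType) (M N : lmodType A) (f : M -> N)
    (fL : linear f) : {linear M -> N} :=
  HB.pack f (GRing.isLinear.Build A M N *:%R f fL).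

(** * Tensor products of modules *)

Section Tensors.
Variables (R : comPzRingType) (M N : lmodType R).

Lemma tpure0l (y : N) : (0 : M) \ox y = 0.
Proof. by rewrite -(scale0r 0) tpureZl scale0r. Qed.

Lemma tpure0r (x : M) : x \ox (0 : N) = 0.
Proof. by rewrite -(scale0r 0) tpureZr scale0r. Qed.

Lemma tpureNl (x : M) (y : N) : (- x) \ox y = - (x \ox y).
Proof. by rewrite -scaleN1r tpureZl scaleN1r. Qed.

Lemma tpureNr (x : M) (y : N) : x \ox (- y) = - (x \ox y).
Proof. by rewrite -scaleN1r tpureZr scaleN1r. Qed.

Lemma tpure_suml (I : Type) (r : seq I) (x : I -> M) (y : N) :
  (\sum_(i <- r) x i) \ox y = \sum_(i <- r) x i \ox y.
Proof.
elim/big_rec2: _ => [|i t x' _ <-]; last exact: tpureDl.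
exact: tpure0l.
Qed.

Lemma tpure_sumr (I : Type) (r : seq I) (x : M) (y : I -> N) :
  x \ox (\sum_(i <- r) y i) = \sum_(i <- r) x \ox y i.
Proof.
elim/big_rec2: _ => [|i t y' _ <-]; last exact: tpureDr.
exact: tpure0r.
Qed.

Lemma tlift_is_linear (W : lmodType R) (f : M -> N -> W) (fB : bilin f) :
  {h : {linear tens M N -> W} | forall x y, h (x \ox y) = f x y}.
Proof.
by exists (linear_of (tlift_linear fB)) => x y; exact: tlift_pure.
Qed.

Lemma tens_eqP (W : lmodType R) (f g : {linear tens M N -> W}) :
  (forall x y, f (x \ox y) = g (x \ox y)) -> f =1 g.
Proof.
move=> fg; elim/tens_ind => [|u v IHu IHv|x y]; last exact: fg.
  by rewrite !linear0.
by rewrite !linearD IHu IHv.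
Qed.
End Tensors.

(** * Tensor products of algebras *)

Section AlgebraTensor.
Variable R : comPzRingType.
Implicit Types S T U A : ralgType R.

Definition alg_hom S T (f : S -> T) := forall r : R, f (alg_map r) = alg_map r.

Lemma alg_homZ S T (f : {rmorphism S -> T}) :
  alg_hom f -> forall r x, f (r *: (x : amod S)) = r *: (f x : amod T).
Proof. by move=> fR r x; rewrite !amodZE rmorphM fR. Qed.

Lemma atens_alg_map S T (r : R) :
  alg_map r = (alg_map r : amod S) \ox (1 : amod T) :> atens S T.
Proof.
have := tpureZl r (1 : amod S) (1 : amod T).
by rewrite amodZE mulr1 => ->.
Qed.

Lemma atensZE S T (r : R) (u : atens S T) : alg_map r * u = r *: u.
Proof.
elim/tens_ind: u => [|u v IHu IHv|s t]; first by rewrite mulr0 scaler0.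
  by rewrite mulrDr scalerDr IHu IHv.
by rewrite atens_alg_map tpureM mul1r; exact: (tpureZl r s t).
Qed.

(** The universal property of the tensor product of algebras; every comparison
    isomorphism between tensor products below is built from it. *)
Lemma atens_hom S T A (f : {rmorphism S -> A}) (g : {rmorphism T -> A}) :
    alg_hom f -> alg_hom g -> (forall s t, f s * g t = g t * f s) ->
  exists h : {rmorphism atens S T -> A}, alg_hom h /\
    forall (s : amod S) (t : amod T), h (s \ox t) = f s * g t.
Proof.
move=> fR gR fg.
have fgB : bilin (fun (s : amod S) (t : amod T) => f s * g t : amod A).
  split=> [t r x y|s r x y].
    by rewrite rmorphD alg_homZ // mulrDl -amodAl.
  by rewrite rmorphD alg_homZ // mulrDr -amodAr.
have [h hE] := tlift_is_linear fgB.
have hB : zmod_morphism (h : atens S T -> A) by move=> x y; exact: linearB.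
have hM : monoid_morphism (h : atens S T -> A).
  split=> [|u v]; first by rewrite hE !rmorph1 mulr1.
  elim/tens_ind: u => [|u u' IH IH'|s t]; first by rewrite !(linear0, mul0r).
    by rewrite mulrDl !linearD mulrDl IH IH'.
  elim/tens_ind: v => [|v v' IH IH'|s' t']; first by rewrite !(linear0, mulr0).
    by rewrite mulrDr !linearD mulrDr IH IH'.
  by rewrite tpureM !hE !rmorphM !mulrA -[_ * g t]mulrA fg !mulrA.
exists (rmorph_of hB hM); split=> [r|s t]; last exact: hE.
by rewrite atens_alg_map /= hE rmorph1 mulr1.
Qed.

Lemma atens_hom_ext S T A (f g : {rmorphism atens S T -> A}) :
  (forall (s : amod S) (t : amod T), f (s \ox t) = g (s \ox t)) -> f =1 g.
Proof.
move=> fg; elim/tens_ind => [|u v IHu IHv|x y]; last exact: fg.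
  by rewrite !rmorph0.
by rewrite !rmorphD IHu IHv.
Qed.

Lemma atens_inl S T : exists f : {rmorphism S -> atens S T}, alg_hom f /\
  forall s : amod S, f s = s \ox (1 : amod T).
Proof.
pose f (s : S) : atens S T := (s : amod S) \ox (1 : amod T).
have fB : zmod_morphism f.
  by move=> x y; rewrite /f tpureDl tpureNl.
have fM : monoid_morphism f by split=> // x y; rewrite tpureM mulr1.
by exists (rmorph_of fB fM); split=> // r; rewrite atens_alg_map.
Qed.

Lemma atens_inr S T : exists f : {rmorphism T -> atens S T}, alg_hom f /\
  forall t : amod T, f t = (1 : amod S) \ox t.
Proof.
pose f (t : T) : atens S T := (1 : amod S) \ox (t : amod T).
have fB : zmod_morphism f.
  by move=> x y; rewrite /f tpureDr tpureNr.
have fM : monoid_morphism f by split=> // x y; rewrite tpureM mulr1.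
exists (rmorph_of fB fM); split=> // r; rewrite atens_alg_map /= /f.
have := tpureZr r (1 : amod S) (1 : amod T).
by rewrite -tpureZl !amodZE !mulr1.
Qed.

Lemma alg_hom_comp S T U (f : {rmorphism S -> T}) (g : {rmorphism T -> U}) :
  alg_hom f -> alg_hom g -> alg_hom (g \o f).
Proof. by move=> fR gR r; rewrite /= fR gR. Qed.

Lemma atens_map S S' T T' (f : {rmorphism S -> S'}) (g : {rmorphism T -> T'}) :
    alg_hom f -> alg_hom g ->
  exists h : {rmorphism atens S T -> atens S' T'}, alg_hom h /\
    forall (s : amod S) (t : amod T),
      h (s \ox t) = (f s : amod S') \ox (g t : amod T').
Proof.
move=> fR gR.
have [i [iR iE]] := atens_inl S' T'; have [j [jR jE]] := atens_inr S' T'.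
have [|h [hR hE]] := atens_hom (alg_hom_comp fR iR) (alg_hom_comp gR jR).
  by move=> s t; rewrite /= iE jE !tpureM !mulr1 !mul1r.
exists h; split=> // s t.
by rewrite hE /= iE jE tpureM mulr1 mul1r.
Qed.

Lemma alg_iso_refl S : alg_iso S S.
Proof. by exists idfun; split=> //; exists id. Qed.

Lemma alg_iso_trans S T U : alg_iso S T -> alg_iso T U -> alg_iso S U.
Proof.
move=> [f [fb fR]] [g [gb gR]]; exists (g \o f); split; first exact: bij_comp.
exact: alg_hom_comp.
Qed.

Lemma bijective_rmorph (A B : pzRingType) (f : {rmorphism A -> B}) :
  bijective f -> exists g : {rmorphism B -> A}, cancel f g /\ cancel g f.
Proof.
move=> [g fK gK].
have gB : zmod_morphism g.
  by move=> x y; apply: (can_inj fK); rewrite rmorphB !gK.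
have gM : monoid_morphism g.
  split=> [|x y]; apply: (can_inj fK); rewrite ?rmorphM !gK ?rmorph1 //.
by exists (rmorph_of gB gM).
Qed.

Lemma alg_iso_sym S T : alg_iso S T -> alg_iso T S.
Proof.
move=> [f [fb fR]]; have [g [fK gK]] := bijective_rmorph fb.
exists g; split; first by exists f.
by move=> r; rewrite -fR fK.
Qed.

Lemma alg_iso_tens S S' T T' :
  alg_iso S S' -> alg_iso T T' -> alg_iso (atens S T) (atens S' T').
Proof.
move=> [f [fb fR]] [g [gb gR]].
have [f' [fK f'K]] := bijective_rmorph fb.
have [g' [gK g'K]] := bijective_rmorph gb.
have f'R : alg_hom f' by move=> r; rewrite -fR fK.
have g'R : alg_hom g' by move=> r; rewrite -gR gK.
have [h [hR hE]] := atens_map fR gR; have [h' [h'R h'E]] := atens_map f'R g'R.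
exists h; split=> //; exists h'.
  by apply: (@atens_hom_ext _ _ _ (h' \o h) idfun) => s t; rewrite /= hE h'E fK gK.
by apply: (@atens_hom_ext _ _ _ (h \o h') idfun) => s t; rewrite /= h'E hE f'K g'K.
Qed.

Lemma alg_iso_tensC S T : alg_iso (atens S T) (atens T S).
Proof.
have swap A B : exists h : {rmorphism atens A B -> atens B A}, alg_hom h /\
    forall (a : amod A) (b : amod B), h (a \ox b) = b \ox a.
  have [i [iR iE]] := atens_inl B A; have [j [jR jE]] := atens_inr B A.
  have [|h [hR hE]] := atens_hom jR iR.
    by move=> a b; rewrite iE jE !tpureM !mulr1 !mul1r.
  by exists h; split=> // a b; rewrite hE iE jE tpureM mulr1 mul1r.
have [h [hR hE]] := swap S T; have [h' [_ h'E]] := swap T S.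
exists h; split=> //; exists h'.
  by apply: (@atens_hom_ext _ _ _ (h' \o h) idfun) => s t; rewrite /= hE h'E.
by apply: (@atens_hom_ext _ _ _ (h \o h') idfun) => s t; rewrite /= h'E hE.
Qed.

Lemma alg_iso_tensA S T U :
  alg_iso (atens (atens S T) U) (atens S (atens T U)).
Proof.
have [i [iR iE]] := atens_inl S (atens T U).
have [j [jR jE]] := atens_inr S (atens T U).
have [i' [i'R i'E]] := atens_inl T U; have [j' [j'R j'E]] := atens_inr T U.
have [k [kR kE]] := atens_inl (atens S T) U.
have [l [lR lE]] := atens_inr (atens S T) U.
have [k' [k'R k'E]] := atens_inl S T; have [l' [l'R l'E]] := atens_inr S T.
have [|p [pR pE]] := atens_hom iR (alg_hom_comp i'R jR).
  by move=> s t; rewrite /= iE jE i'E !tpureM !mulr1 !mul1r.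
have [|h [hR hE]] := atens_hom pR (alg_hom_comp j'R jR).
  move=> u v; elim/tens_ind: u => [|u u' IH IH'|s t].
  - by rewrite rmorph0 mul0r mulr0.
  - by rewrite rmorphD mulrDl mulrDr IH IH'.
  - by rewrite pE /= iE !jE i'E j'E !tpureM !mulr1 !mul1r.
have [|q [qR qE]] := atens_hom (alg_hom_comp l'R kR) lR.
  by move=> s t; rewrite /= kE lE l'E !tpureM !mulr1 !mul1r.
have [|h' [h'R h'E]] := atens_hom (alg_hom_comp k'R kR) qR.
  move=> v u; elim/tens_ind: u => [|u u' IH IH'|s t].
  - by rewrite rmorph0 mul0r mulr0.
  - by rewrite rmorphD mulrDl mulrDr IH IH'.
  - by rewrite qE /= !kE lE l'E k'E !tpureM !mulr1 !mul1r.
have hE3 (s : amod S) (t : amod T) (u : amod U) :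
    h (((s \ox t) : amod (atens S T)) \ox u)
      = s \ox ((t \ox u) : amod (atens T U)).
  rewrite hE /= pE /= iE !jE i'E j'E !tpureM !mulr1 !mul1r.
  by congr (_ \ox _); rewrite [LHS]tpureM mulr1 mul1r.
have h'E3 (s : amod S) (t : amod T) (u : amod U) :
    h' (s \ox ((t \ox u) : amod (atens T U)))
      = ((s \ox t) : amod (atens S T)) \ox u.
  rewrite h'E /= qE /= !kE !lE l'E k'E !tpureM !mulr1 !mul1r.
  by congr (_ \ox _); rewrite [LHS]tpureM mulr1 mul1r.
exists h; split=> //; exists h'.
  apply: (@atens_hom_ext _ _ _ (h' \o h) idfun) => + u.
  elim/tens_ind=> [|v v' IH IH'|s t]; last by rewrite /= hE3 h'E3.
    by rewrite tpure0l !rmorph0.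
  by rewrite tpureDl !rmorphD IH IH'.
apply: (@atens_hom_ext _ _ _ (h \o h') idfun) => s.
elim/tens_ind=> [|v v' IH IH'|t u]; last by rewrite /= h'E3 hE3.
  by rewrite tpure0r !rmorph0.
by rewrite tpureDr !rmorphD IH IH'.
Qed.
End AlgebraTensor.

(** * Finitely generated projective modules and dual bases *)

Section DualBasis.
Variable R : comPzRingType.
Implicit Types P Q M N : lmodType R.

Lemma tmap_bilin M M' N N' (f : {linear M -> M'}) (g : {linear N -> N'}) :
  bilin (fun x y => f x \ox g y).
Proof.
split=> [y r x x'|x r y y']; first by rewrite linearP tpureDl tpureZl.
by rewrite linearP tpureDr tpureZr.
Qed.

Definition tmap M M' N N' (f : {linear M -> M'}) (g : {linear N -> N'}) :
  {linear tens M N -> tens M' N'} := sval (tlift_is_linear (tmap_bilin f g)).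

Lemma tmapE M M' N N' (f : {linear M -> M'}) (g : {linear N -> N'}) x y :
  tmap f g (x \ox y) = f x \ox g y.
Proof. exact: (svalP (tlift_is_linear (tmap_bilin f g))). Qed.

Lemma tform_bilin M N (f : {linear M -> R^o}) (g : {linear N -> R^o}) :
  bilin (fun x y => f x * g y : R^o).
Proof.
split=> [y r x x'|x r y y']; first by rewrite linearP mulrDl /GRing.scale /= !mulrA.
by rewrite linearP mulrDr /GRing.scale /= !mulrA [r * _]mulrC.
Qed.

(** The product of two linear forms, as a form on the tensor product. *)
Definition tform M N (f : {linear M -> R^o}) (g : {linear N -> R^o}) :
  {linear tens M N -> R^o} := sval (tlift_is_linear (tform_bilin f g)).

Lemma tformE M N (f : {linear M -> R^o}) (g : {linear N -> R^o}) x y :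
  tform f g (x \ox y) = f x * g y.
Proof. exact: (svalP (tlift_is_linear (tform_bilin f g))). Qed.

Lemma tcontr_bilin M N (g : {linear N -> R^o}) :
  bilin (fun (x : M) y => (g y : R) *: x).
Proof.
split=> [y r x x'|x r y y']; first by rewrite scalerDr !scalerA mulrC.
by rewrite linearP scalerDl scalerA.
Qed.

(** Contraction of the second factor, id (x) g followed by N (x) R = N. *)
Definition tcontr M N (g : {linear N -> R^o}) : {linear tens M N -> M} :=
  sval (tlift_is_linear (tcontr_bilin M g)).

Lemma tcontrE M N (g : {linear N -> R^o}) (x : M) y :
  tcontr M g (x \ox y) = (g y : R) *: x.
Proof. exact: (svalP (tlift_is_linear (tcontr_bilin M g))). Qed.

Definition dual_basis P (I : finType) (p : I -> P) (f : I -> {linear P -> R^o}) :=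
  forall x, x = \sum_i f i x *: p i.

Lemma dual_basis_fg P (I : finType) (p : I -> P) (f : I -> {linear P -> R^o}) :
  dual_basis p f -> finitely_generated P.
Proof.
move=> pf; exists #|I|, (fun i => p (enum_val i)) => x.
exists (fun i => f (enum_val i) x).
by rewrite {1}[x]pf (reindex _ (onW_bij _ (@enum_val_bij I))).
Qed.

Lemma dual_basis_projective P (I : finType) (p : I -> P)
    (f : I -> {linear P -> R^o}) :
  dual_basis p f -> projective P.
Proof.
move=> pf M N q h q_onto.
have [y yP] := choice (fun i => q_onto (h (p i))).
have gL : linear (fun x => \sum_i f i x *: y i).
  move=> r x x'; rewrite scaler_sumr -big_split /=; apply: eq_bigr => i _.
  by rewrite linearP scalerDl scalerA.
exists (linear_of gL) => x /=.
rewrite linear_sum {2}[x]pf linear_sum; apply: eq_bigr => i _.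
by rewrite !linearZ yP.
Qed.

(** Split the surjection from a free module given by a family of generators;
    the coordinates of the section are the dual forms. *)
Lemma fg_projective_dual_basis P :
    finitely_generated P -> projective P ->
  exists (I : finType) (p : I -> P) (f : I -> {linear P -> R^o}), dual_basis p f.
Proof.
move=> [n [p gen]] proj.
pose q (v : {ffun 'I_n -> R^o}) : P := \sum_i (v i : R) *: p i.
have qL : linear q.
  move=> r v w; rewrite scaler_sumr -big_split /=; apply: eq_bigr => i _.
  by rewrite !ffunE scalerDl scalerA.
have [y|g gK] := proj _ _ (linear_of qL) idfun.
  have [c ->] := gen y; exists [ffun i => c i].
  by apply: eq_bigr => i _; rewrite ffunE.
have fL i : linear (fun x => g x i : R^o).
  by move=> r x y; rewrite linearP !ffunE.
exists 'I_n, p, (fun i => linear_of (fL i)).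
by move=> x; rewrite -{1}[x]gK.
Qed.

Lemma dual_basis_tens P Q (I J : finType) (p : I -> P) (f : I -> {linear P -> R^o})
    (q : J -> Q) (g : J -> {linear Q -> R^o}) :
    dual_basis p f -> dual_basis q g ->
  dual_basis (fun k : I * J => p k.1 \ox q k.2) (fun k => tform (f k.1) (g k.2)).
Proof.
move=> pf qg; elim/tens_ind=> [|u v IHu IHv|x y].
- by rewrite big1 // => k _; rewrite linear0 scale0r.
- rewrite {1}IHu {1}IHv -big_split; apply: eq_bigr => k _.
  by rewrite linearD scalerDl.
- rewrite {1}[x]pf {1}[y]qg tpure_suml.
  rewrite (eq_bigr _ (fun i _ => tpure_sumr _ _ _)) pair_big /=.
  by apply: eq_bigr => k _; rewrite tpureZl tpureZr scalerA tformE.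
Qed.

Definition progenerator P := [/\ finitely_generated P, projective P & faithful P].

Lemma progenerator_dual_basis P :
    progenerator P ->
  exists (I : finType) (p : I -> P) (f : I -> {linear P -> R^o}), dual_basis p f.
Proof. by case=> fg proj _; exact: fg_projective_dual_basis. Qed.

(** If a kills P (x) Q, contracting with g_j shows that a g_j(y) kills P, so it
    is zero; the expansion of y in the dual basis then shows that a kills Q. *)
Lemma faithful_tens P Q (J : finType) (q : J -> Q) (g : J -> {linear Q -> R^o}) :
  dual_basis q g -> faithful P -> faithful Q -> faithful (tens P Q).
Proof.
move=> qg faiP faiQ a a0; apply: (faiQ) => y; rewrite [y]qg.
rewrite scaler_sumr big1 // => j _; rewrite scalerA.
suff -> : a * g j y = 0 by rewrite scale0r.
apply: faiP => x.
by rewrite -scalerA -tcontrE -linearZ a0 linear0.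
Qed.

Lemma dual_basis_progenerator P (I : finType) (p : I -> P)
    (f : I -> {linear P -> R^o}) :
  dual_basis p f -> faithful P -> progenerator P.
Proof.
by move=> pf; split=> //;
  [exact: dual_basis_fg pf | exact: dual_basis_projective pf].
Qed.

Lemma progenerator_tens P Q :
  progenerator P -> progenerator Q -> progenerator (tens P Q).
Proof.
move=> Pg Qg; have [[_ _ faiP] [_ _ faiQ]] := (Pg, Qg).
have [I [p [f pf]]] := progenerator_dual_basis Pg.
have [J [q [g qg]]] := progenerator_dual_basis Qg.
apply: dual_basis_progenerator (dual_basis_tens pf qg) _.
exact: faithful_tens qg _ _.
Qed.

Lemma dual_basis_regular :
  dual_basis (fun _ : unit => 1 : R^o) (fun _ => idfun : {linear R^o -> R^o}).
Proof. by move=> x; rewrite big_const card_unit /= addr0; exact/esym/mulr1. Qed.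

Lemma progenerator_regular : progenerator (R^o : lmodType R).
Proof.
apply: dual_basis_progenerator dual_basis_regular _ => a a0.
by rewrite -[a]mulr1; exact: a0.
Qed.

End DualBasis.

(** * Endomorphism algebras *)

Section EndoTensor.
Variable R : comPzRingType.
Implicit Types P Q : lmodType R.

Lemma endo_sumE P (I : Type) (r : seq I) (F : I -> endo P) x :
  (\sum_(i <- r) F i) x = \sum_(i <- r) F i x.
Proof. by elim/big_rec2: _ => // i y phi _ <-. Qed.

Lemma rank_one_linear P (f : {linear P -> R^o}) (p : P) :
  linear (fun x => (f x : R) *: p).
Proof. by move=> r x y; rewrite linearP scalerDl scalerA. Qed.

Definition rank_one P (f : {linear P -> R^o}) (p : P) : endo P :=
  linear_of (rank_one_linear f p).

(** The matrix of phi: expand first x, then each phi(p_i), in the dual basis. The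
    rank one map f_i(-) p_k gets the coefficient f_k(phi(p_i)). *)
Lemma endo_dual_basis P (I : finType) (p : I -> P) (f : I -> {linear P -> R^o})
    (phi : endo P) :
    dual_basis p f ->
  phi = \sum_(a : I * I)
          alg_map (f a.2 (phi (p a.1)) : R) * rank_one (f a.1) (p a.2).
Proof.
move=> pf; apply: endoP => x.
rewrite endo_sumE -(pair_bigA _ (fun i k =>
  (alg_map (f k (phi (p i)) : R) * rank_one (f i) (p k)) x)) /=.
rewrite {1}[x]pf linear_sum; apply: eq_bigr => i _.
rewrite linearZ_LR {1}[phi (p i)]pf scaler_sumr; apply: eq_bigr => k _.
by rewrite !scalerA mulrC.
Qed.

(** The inverse reads off the matrix of an endomorphism in the dual basis of P
    (x) Q; by endo_dual_basis, both composites amount to expanding an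
    endomorphism in rank one maps. *)
Lemma endo_tens P Q : progenerator P -> progenerator Q ->
  alg_iso (atens (endo P) (endo Q)) (endo (tens P Q)).
Proof.
move=> Pg Qg.
have [I [p [f pf]]] := progenerator_dual_basis Pg.
have [J [q [g qg]]] := progenerator_dual_basis Qg.
pose l (phi : endo P) : endo (tens P Q) := tmap phi idfun.
pose r (psi : endo Q) : endo (tens P Q) := tmap idfun psi.
have lE phi x y : l phi (x \ox y) = phi x \ox y by exact: tmapE.
have rE psi x y : r psi (x \ox y) = x \ox psi y by exact: tmapE.
have lB : zmod_morphism l.
  move=> phi psi; apply/endoP/tens_eqP => x y.
  by rewrite [RHS]/= !lE /= tpureDl tpureNl.
have rB : zmod_morphism r.
  move=> phi psi; apply/endoP/tens_eqP => x y.
  by rewrite [RHS]/= !rE /= tpureDr tpureNr.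
have lM : monoid_morphism l.
  split=> [|phi psi]; apply/endoP/tens_eqP => x y; rewrite [RHS]/= !lE //.
have rM : monoid_morphism r.
  split=> [|phi psi]; apply/endoP/tens_eqP => x y; rewrite [RHS]/= !rE //.
have lR : alg_hom (rmorph_of lB lM).
  by move=> a; apply/endoP/tens_eqP => x y; rewrite /= lE /= tpureZl.
have rR : alg_hom (rmorph_of rB rM).
  by move=> a; apply/endoP/tens_eqP => x y; rewrite /= rE /= tpureZr.
have [|h [hR hE]] := atens_hom lR rR.
  by move=> phi psi; apply/endoP/tens_eqP => x y; rewrite /= rE !lE rE.
exists h; split=> //.
have {}hE phi psi x y : h (phi \ox psi) (x \ox y) = phi x \ox psi y.
  by rewrite hE /= rE lE.
pose k (chi : endo (tens P Q)) : atens (endo P) (endo Q) :=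
  \sum_(a : (I * J) * (I * J))
    (tform (f a.2.1) (g a.2.2) (chi (p a.1.1 \ox q a.1.2)) : R) *:
    ((rank_one (f a.1.1) (p a.2.1) : amod (endo P))
      \ox (rank_one (g a.1.2) (q a.2.2) : amod (endo Q))).
have kD chi chi' : k (chi + chi') = k chi + k chi'.
  rewrite /k -big_split; apply: eq_bigr => a _ /=.
  by rewrite linearD scalerDl.
have k0 : k 0 = 0 by apply: (addrI (k 0)); rewrite -kD !addr0.
exists k => [u|chi]; last first.
  rewrite [RHS](endo_dual_basis _ (dual_basis_tens pf qg)) rmorph_sum.
  apply: eq_bigr => a _; rewrite -atensZE rmorphM hR; congr (_ * _).
  apply/endoP/tens_eqP => x y; rewrite hE /= tformE.
  by rewrite tpureZl tpureZr scalerA.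
elim/tens_ind: u => [|u v IHu IHv|phi psi].
- by rewrite rmorph0 k0.
- by rewrite (_ : h (u + v) = h u + h v) ?kD ?IHu ?IHv //; exact: rmorphD.
rewrite [phi in RHS](endo_dual_basis _ pf) [psi in RHS](endo_dual_basis _ qg).
rewrite tpure_suml (eq_bigr _ (fun i _ => tpure_sumr _ _ _)) pair_big /=.
rewrite /k (reindex (fun a : (I * I) * (J * J) =>
  ((a.1.1, a.2.1), (a.1.2, a.2.2)))) /=; last first.
  apply: onW_bij; exists (fun a : (I * J) * (I * J) =>
    ((a.1.1, a.2.1), (a.1.2, a.2.2))); by move=> [[? ?] [? ?]].
apply: eq_bigr => a _; rewrite hE tformE.
rewrite -scalerA -tpureZr -tpureZl //.
Qed.

Lemma endo_regular : alg_iso (endo (R^o : lmodType R)) R^o.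
Proof.
pose h (phi : endo (R^o : lmodType R)) : R^o := phi 1.
have hB : zmod_morphism h by [].
have hZ (phi : endo (R^o : lmodType R)) (r : R^o) : phi r = r * phi 1.
  by rewrite -[r in LHS]mulr1; exact: (linearZ_LR phi r (1 : R^o)).
have hM : monoid_morphism h.
  by split=> // phi psi; rewrite /h /= hZ mulrC.
exists (rmorph_of hB hM); split; last by move=> r; exact: mulr1.
exists (fun r : R^o => alg_map (r : R)) => [phi|r]; last exact: mulr1.
by apply: endoP => x; rewrite /= [RHS]hZ; exact: mulrC.
Qed.

End EndoTensor.

(** * Brauer equivalence *)

Section BrauerEquivalence.
Variable R : comPzRingType.
Implicit Types S T U A B C D : ralgType R.

Lemma alg_iso_tensAC A B C : alg_iso (atens (atens A B) C) (atens (atens A C) B).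
Proof.
apply: alg_iso_trans (alg_iso_tensA _ _ _) _.
apply: alg_iso_trans (alg_iso_sym (alg_iso_tensA _ _ _)).
exact: alg_iso_tens (alg_iso_refl _) (alg_iso_tensC _ _).
Qed.

Lemma alg_iso_tensACA A B C D :
  alg_iso (atens (atens A B) (atens C D)) (atens (atens A C) (atens B D)).
Proof.
apply: alg_iso_trans (alg_iso_sym (alg_iso_tensA _ _ _)) _.
apply: alg_iso_trans (alg_iso_tensA _ _ _).
exact: alg_iso_tens (alg_iso_tensAC _ _ _) (alg_iso_refl _).
Qed.

Lemma alg_iso_brauer S T : alg_iso S T -> brauer_equiv S T.
Proof.
move=> iso; exists R^o, R^o; split; try exact: progenerator_regular.
exact: alg_iso_tens iso (alg_iso_refl _).
Qed.

Lemma brauer_equiv_refl S : brauer_equiv S S.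
Proof. exact/alg_iso_brauer/alg_iso_refl. Qed.

Lemma brauer_equiv_sym S T : brauer_equiv S T -> brauer_equiv T S.
Proof. by move=> [P [Q [Pg Qg iso]]]; exists Q, P; split=> //; exact: alg_iso_sym. Qed.

(** Tensoring the two isomorphisms with End(P') and End(Q) makes the middle
    terms agree, and endo_tens merges the two endomorphism algebras on either
    side. *)
Lemma brauer_equiv_trans S T U :
  brauer_equiv S T -> brauer_equiv T U -> brauer_equiv S U.
Proof.
move=> [P [Q [Pg Qg ST]]] [P' [Q' [P'g Q'g TU]]].
exists (tens P P'), (tens Q' Q); split; try exact: progenerator_tens.
have split_endo A X Y : progenerator X -> progenerator Y ->
    alg_iso (atens A (endo (tens X Y))) (atens (atens A (endo X)) (endo Y)).
  move=> Xg Yg; apply: alg_iso_trans (alg_iso_sym (alg_iso_tensA _ _ _)).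
  exact: alg_iso_tens (alg_iso_refl _) (alg_iso_sym (endo_tens Xg Yg)).
apply: alg_iso_trans (split_endo S P P' Pg P'g) _.
apply: alg_iso_trans (alg_iso_tens ST (alg_iso_refl _)) _.
apply: alg_iso_trans (alg_iso_tensAC _ _ _) _.
apply: alg_iso_trans (alg_iso_tens TU (alg_iso_refl _)) _.
exact: alg_iso_sym (split_endo U Q' Q Q'g Qg).
Qed.

Lemma brauer_equiv_tens S S' T T' :
  brauer_equiv S S' -> brauer_equiv T T' -> brauer_equiv (atens S T) (atens S' T').
Proof.
move=> [P [P' [Pg P'g SS']]] [Q [Q' [Qg Q'g TT']]].
exists (tens P Q), (tens P' Q'); split; try exact: progenerator_tens.
have interchange A B X Y : progenerator X -> progenerator Y ->
    alg_iso (atens (atens A B) (endo (tens X Y)))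
            (atens (atens A (endo X)) (atens B (endo Y))).
  move=> Xg Yg; apply: alg_iso_trans (alg_iso_tensACA _ _ _ _).
  exact: alg_iso_tens (alg_iso_refl _) (alg_iso_sym (endo_tens Xg Yg)).
apply: alg_iso_trans (interchange S T P Q Pg Qg) _.
apply: alg_iso_trans (alg_iso_tens SS' TT') _.
exact: alg_iso_sym (interchange S' T' P' Q' P'g Q'g).
Qed.

Lemma brauer_equiv_class S T : brauer_equiv S T -> brauer_class S = brauer_class T.
Proof.
move=> ST; apply/funext => U; apply/propext; split=> -[aU eqU]; split=> //.
  exact: brauer_equiv_trans (brauer_equiv_sym ST) eqU.
exact: brauer_equiv_trans ST eqU.
Qed.

(** Brauer equivalence being compatible with tensor products, the choice of
    representatives does not matter. *)
Lemma br_mul_class S T : azumaya S -> azumaya T ->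
  br_mul (brauer_class S) (brauer_class T) = brauer_class (atens S T).
Proof.
move=> aS aT; apply/funext => U; apply/propext; split=> -[aU eqU]; split=> //.
  have [S' [T' [[_ SS'] [_ TT'] eqU']]] := eqU.
  exact: brauer_equiv_trans (brauer_equiv_tens SS' TT') eqU'.
by exists S, T; split=> //; split=> //; exact: brauer_equiv_refl.
Qed.

Lemma alg_iso_endo_br_one S P :
  progenerator P -> alg_iso S (endo P) -> brauer_class S = @br_one R.
Proof.
move=> Pg iso; apply: brauer_equiv_class; exists R^o, P.
split=> //; first exact: progenerator_regular.
apply: alg_iso_trans (alg_iso_tensC _ _).
exact: alg_iso_tens iso (endo_regular R).
Qed.

End BrauerEquivalence.

Lemma tens_sum (R : comPzRingType) (M N : lmodType R) (t : tens M N) :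
  exists (I : finType) (x : I -> M) (y : I -> N), t = \sum_i x i \ox y i.
Proof.
pose u := trep t; exists 'I_(size u).
exists (fun i => (tnth (in_tuple u) i).1), (fun i => (tnth (in_tuple u) i).2).
by rewrite -[t in LHS]trepK tclsE big_tnth.
Qed.

(** * A criterion for faithful flatness *)

Section FaithfullyFlat.
Variables (R : comPzRingType) (M : lmodType R).

Lemma tmaplE (N N' : lmodType R) (f : {linear N -> N'}) :
  tmapl (N := M) f =1 tmap f idfun.
Proof.
move=> u; apply: (@tens_eqP _ _ _ _ (linear_of (tlift_linear (tmapl_bilin _ f)))).
by move=> x y; rewrite tmapE; exact: (tlift_pure (tmapl_bilin _ f)).
Qed.

Lemma tcontr_tmap (N N' : lmodType R) (f : {linear N -> N'})
    (g : {linear M -> R^o}) (u : tens N M) :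
  tcontr N' g (tmap f idfun u) = f (tcontr N g u).
Proof.
apply: (@tens_eqP _ _ _ _ (tcontr N' g \o tmap f idfun) (f \o tcontr N g)).
by move=> x y; rewrite /= tmapE !tcontrE linearZ_LR.
Qed.

Lemma tcontr_dual_basis (N : lmodType R) (I : finType) (p : I -> M)
    (f : I -> {linear M -> R^o}) (u : tens N M) :
  dual_basis p f -> u = \sum_i tcontr N (f i) u \ox p i.
Proof.
move=> pf; elim/tens_ind: u => [|u v IHu IHv|x y].
- by rewrite big1 // => i _; rewrite linear0 tpure0l.
- rewrite {1}IHu {1}IHv -big_split; apply: eq_bigr => i _.
  by rewrite linearD tpureDl.
- rewrite {1}[y]pf tpure_sumr; apply: eq_bigr => i _.
  by rewrite tcontrE tpureZl tpureZr.
Qed.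

(** Tensoring with M preserves exactness since an element of N (x) M is
    determined by its contractions with the forms f_i, which commute with the
    maps of the sequence. It reflects exactness since rho contracts y (x) m
    back to y. *)
Lemma split_faithfully_flat (I : finType) (p : I -> M)
    (f : I -> {linear M -> R^o}) (m : M) (rho : {linear M -> R^o}) :
  dual_basis p f -> rho m = 1 -> faithfully_flat M.
Proof.
move=> pf rho_m N1 N2 N3 l h; split=> exact_lh.
  move=> u; rewrite tmaplE; split=> [hu0|[t <-]]; last first.
    rewrite tmaplE [LHS](tcontr_dual_basis _ pf) big1 // => i _.
    by rewrite !tcontr_tmap (_ : h _ = 0) ?tpure0l //; apply/exact_lh; eexists.
  have lift i : exists x, l x = tcontr N2 (f i) u.
    by apply/exact_lh; rewrite -tcontr_tmap hu0 linear0.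
  have [x lx] := choice lift; exists (\sum_i x i \ox p i).
  rewrite tmaplE linear_sum [RHS](tcontr_dual_basis _ pf).
  by apply: eq_bigr => i _; rewrite tmapE lx.
move=> y; split=> [hy0|[x <-]].
  have /exact_lh[t] : tmapl (N := M) h (y \ox m) = 0.
    by rewrite tmaplE tmapE hy0 tpure0l.
  rewrite tmaplE => /(congr1 (tcontr N2 rho)).
  by rewrite tcontr_tmap tcontrE rho_m scale1r => <-; eexists.
have : tmapl (N := M) h (l x \ox m) = 0.
  by apply/exact_lh; exists (x \ox m); rewrite tmaplE tmapE.
move/(congr1 (tcontr N3 rho)); rewrite tmaplE tmapE tcontrE rho_m scale1r.
by rewrite linear0.
Qed.
End FaithfullyFlat.

(** * Casimir elements and separability *)

Section Casimir.
Variables (R : comPzRingType) (S : ralgType R) (I : finType) (a b : I -> S).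

Local Notation tp := (@tpure R (amod S) (amod S)).

(** The equation x e = e x for e = sum_i a_i (x) b_i and the outer bimodule
    structure of S (x) S. *)
Definition casimir := forall x : S,
  \sum_i tp (x * a i) (b i) = \sum_i tp (a i) (b i * x).

Hypothesis ab : casimir.

Lemma casimir_bilin (W : lmodType R) (f : amod S -> amod S -> W) x :
  bilin f -> \sum_i f (x * a i) (b i) = \sum_i f (a i) (b i * x).
Proof.
move=> fB; have [h hE] := tlift_is_linear fB.
have := congr1 h (ab x); rewrite !linear_sum.
by under eq_bigr do rewrite hE; under [RHS]eq_bigr do rewrite hE.
Qed.

Lemma sandwich_bilin s : bilin (fun x y : amod S => x * s * y : amod S).
Proof.
split=> [y r x x'|x r y y']; first by rewrite !mulrDl -!amodAl.
by rewrite mulrDr amodAr.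
Qed.

Definition sandwich s := \sum_i a i * s * b i.

Lemma sandwich_central s x : sandwich s * x = x * sandwich s.
Proof.
have := casimir_bilin x (sandwich_bilin s).
rewrite /sandwich mulr_suml mulr_sumr => E.
transitivity (\sum_i a i * s * (b i * x)); last rewrite -[LHS]E;
  by apply: eq_bigr => i _; rewrite !mulrA.
Qed.

Lemma sandwich_linear : linear (sandwich : amod S -> amod S).
Proof.
move=> r x y; rewrite /sandwich scaler_sumr -big_split; apply: eq_bigr => i _.
by rewrite mulrDr mulrDl -amodAr -amodAl.
Qed.

(** For a Casimir element e whose product is 1, the map s |-> (s (x) 1) e from
    S to the enveloping algebra is linear over that algebra, and it splits the
    multiplication; so any preimage m of f(1) gives the lift s |-> (s (x) 1) e
    m. *)
Lemma casimir_separable : \sum_i a i * b i = 1 -> separable S.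
Proof.
move=> ab1 M N q f q_onto.
have [m mP] := q_onto (f 1).
pose op (s : amod S) (t : amod S) : enveloping S := s \ox (t : amod S^c).
have opB : bilin (op : _ -> _ -> tens (amod S) (amod S^c)).
  split=> [t r s s'|s r t t']; first by rewrite /op tpureDl tpureZl.
  rewrite /op tpureDr -tpureZr; congr (_ \ox _ + _).
  exact: (alg_mapC r (t : S)).
pose e := \sum_i op (a i) (b i).
have opM s t s' t' : op s t * op s' t' = op (s * s') (t' * t).
  exact: (@tpureM R S S^c).
(* In the enveloping algebra the right factor is multiplied in reverse order,
   so this is the Casimir equation. *)
have eC x : op x 1 * e = op 1 x * e.
  have := casimir_bilin x opB; rewrite /e !mulr_sumr => E.
  under eq_bigr do rewrite opM mulr1.
  by under [RHS]eq_bigr do rewrite opM mul1r.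
have opZ s t (x : bimod S) : op s t *: x = s * x * t.
  exact: env_scale_pure.
have op1D s s' : op (s + s') 1 = op s 1 + op s' 1 by exact: tpureDl.
pose g (s : bimod S) := (op s 1 * e) *: m.
have gD s s' : g (s + s') = g s + g s'.
  by rewrite /g op1D mulrDl scalerDl.
have g0 : g 0 = 0 by apply: (addrI (g 0)); rewrite -gD !addr0.
have gL : linear g.
  move=> u s s'; rewrite gD; congr (_ + _).
  elim/tens_ind: u => [|u v IHu IHv|x y]; first by rewrite !scale0r g0.
    by rewrite !scalerDl gD IHu IHv.
  rewrite -/(op x y) opZ /g scalerA mulrA opM mul1r; congr (_ *: _).
  transitivity (op (x * s) 1 * (op y 1 * e)); first by rewrite mulrA opM mulr1.
  by rewrite eC mulrA opM mulr1 mulr1.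
exists (linear_of gL) => s /=.
rewrite /g linearZ_LR mP -linearZ_LR; congr (f _).
rewrite -scalerA scaler_suml (eq_bigr (fun i => a i * b i)) ?ab1.
  by rewrite opZ !mulr1.
by move=> i _; rewrite opZ mulr1.
Qed.
End Casimir.

Lemma central_lift (R : comPzRingType) (S : ralgType R) (W : lmodType R)
    (F : W -> amod S) :
    central S -> linear F -> (forall w, exists r : R, F w = alg_map r) ->
  exists rho : {linear W -> R^o}, forall w, F w = alg_map (rho w : R).
Proof.
move=> [injS _] FL /choice[rho rhoP].
have rhoL : linear (rho : W -> R^o).
  move=> r x y; apply: injS; rewrite -rhoP FL amodZE !rhoP.
  by rewrite rmorphD rmorphM.
by exists (linear_of rhoL).
Qed.

(** * Galois coordinates *)

Section GaloisCoordinates.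
Variables (R : comPzRingType) (S : ralgType R) (G : finGroupType).
Variable act : G -> {rmorphism S -> S}.
Local Notation tp := (@tpure R (amod S) (amod S)).

Definition trace s := \sum_g act g s.

(** For an algebra with center R these families exist exactly for the Galois
    extensions (galois_extension_coords, coords_galois_azumaya). Unlike the
    bijectivity of the Galois map, the three equations pass to tensor products
    and opposite algebras by direct computation. *)
Definition galois_coords (I : finType) (a b : I -> S) :=
  [/\ forall g, \sum_i a i * act g (b i) = (g == 1%g)%:R,
      casimir a b
    & forall s, exists r : R, trace s = alg_map r].

Hypothesis actP : galois_action act.

Lemma galois_act1 s : act 1%g s = s. Proof. by have [] := actP. Qed.
Lemma galois_actM g h s : act (g * h)%g s = act g (act h s).
Proof. by have [_ ->] := actP. Qed.
Lemma galois_act_alg g (r : R) : act g (alg_map r) = alg_map r.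
Proof. by have [_ _ ->] := actP. Qed.
Lemma galois_actZ g r (x : amod S) : act g (r *: x) = r *: (act g x : amod S).
Proof. by rewrite !amodZE rmorphM galois_act_alg. Qed.
Lemma galois_act_linear g : linear (act g : amod S -> amod S).
Proof. by move=> r x y; rewrite rmorphD galois_actZ. Qed.

Lemma galois_map_linear g :
  linear (fun u : tens (amod S) (amod S) => galois_map act u g : amod S).
Proof.
have B : bilin (fun s t : amod S => s * act g t : amod S).
  split=> [y r x x'|x r y y']; first by rewrite mulrDl -amodAl.
  by rewrite galois_act_linear mulrDr -amodAr.
by move=> r u v; rewrite !ffunE (tlift_linear B).
Qed.

Lemma galois_mapE (I : finType) (x y : I -> S) g :
  galois_map act (\sum_i tp (x i) (y i)) g
    = \sum_i x i * act g (y i).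
Proof.
rewrite -[LHS]/(linear_of (galois_map_linear g) _) linear_sum.
by apply: eq_bigr => i _; exact: galois_map_pure.
Qed.

Lemma trace_linear : linear (trace : amod S -> amod S).
Proof.
move=> r x y; rewrite /trace scaler_sumr -big_split; apply: eq_bigr => g _.
exact: galois_act_linear.
Qed.

Lemma galois_act_trace g s : act g (trace s) = trace s.
Proof.
rewrite /trace rmorph_sum [RHS](reindex_inj (mulgI g)) /=.
by apply: eq_bigr => h _; rewrite galois_actM.
Qed.

(** All three properties are read off through the injective Galois map. It
    sends e to the Dirac function at 1, and both x e and e x to x times that
    function. It does not distinguish 1 (x) t from t (x) 1 when t is a trace,
    so these tensors are equal; applying the sandwich map to the second factor
    gives that t is its own sandwich, hence central. *)
Lemma galois_extension_coords :
    central S -> bijective (galois_map act) ->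
  exists (I : finType) (a b : I -> S), galois_coords a b.
Proof.
move=> [_ centrS] [gi giK Kgi].
have [I [a [b eE]]] := tens_sum (gi [ffun g => (g == 1%g)%:R]).
change (I -> S) in a; change (I -> S) in b.
have abE g : \sum_i a i * act g (b i) = (g == 1%g)%:R.
  by rewrite -galois_mapE -eE Kgi ffunE.
have ab : casimir a b.
  move=> x; apply: (can_inj giK); apply/ffunP => g; rewrite !galois_mapE.
  under eq_bigr do rewrite -mulrA; rewrite -mulr_sumr abE.
  under [RHS]eq_bigr do rewrite rmorphM mulrA; rewrite -mulr_suml abE.
  by case: eqP => [->|_]; rewrite ?mulr0 ?mul0r // galois_act1 mulr1 mul1r.
exists I, a, b; split=> // s; apply: centrS => x.
set t := trace s.
have tE : tp 1 t = tp t 1.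
  apply: (can_inj giK); apply/ffunP => g; rewrite !galois_map_pure //.
  by rewrite galois_act_trace rmorph1 mul1r mulr1.
pose L := linear_of (sandwich_linear a b).
have B : bilin (fun x y : amod S => x * L y : amod S).
  split=> [y r z z'|z r y y']; first by rewrite mulrDl -amodAl.
  by rewrite linearP mulrDr -amodAr.
(* Every sandwich is central, so it suffices that t is its own sandwich. *)
suff <- : sandwich a b t = t by exact: sandwich_central.
have := congr1 (tlift (fun x y : amod S => x * L y : amod S)) tE.
rewrite !tlift_pure // mul1r /= => ->.
rewrite /sandwich (eq_bigr (fun i => a i * act 1%g (b i))) ?abE ?eqxx ?mulr1 //.
by move=> i _; rewrite mulr1 galois_act1.
Qed.

Section Coordinates.
Variables (I : finType) (a b : I -> S).
Hypothesis coords : galois_coords a b.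

Let abE g : \sum_i a i * act g (b i) = (g == 1%g)%:R.
Proof. by have [] := coords. Qed.
Let ab : casimir a b. Proof. by have [] := coords. Qed.

Lemma coords_mul1 : \sum_i a i * b i = 1.
Proof.
have := abE 1%g; rewrite eqxx => abE1; rewrite -[RHS]abE1.
by apply: eq_bigr => i _; rewrite galois_act1.
Qed.

(** Apply g to the equation for the inverse of g. *)
Lemma coords_act g : \sum_i act g (a i) * b i = (g == 1%g)%:R.
Proof.
have := congr1 (act g) (abE g^-1%g); rewrite invg_eq1 rmorph_nat => <-.
rewrite rmorph_sum; apply: eq_bigr => i _.
by rewrite rmorphM -galois_actM mulgV galois_act1.
Qed.

(** Summing the defining equations over g leaves only the term of g = 1. *)
Lemma coords_trace x : \sum_i a i * trace (b i * x) = x.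
Proof.
under eq_bigr do rewrite mulr_sumr.
rewrite exchange_big (bigD1 1%g) //= [X in _ + X]big1 => [|g g1].
  rewrite addr0 -[RHS]mul1r -coords_mul1 mulr_suml.
  by apply: eq_bigr => i _; rewrite galois_act1 mulrA.
under eq_bigr do rewrite rmorphM mulrA.
by rewrite -mulr_suml abE (negPf g1) mul0r.
Qed.

Lemma trace_coords x : \sum_i trace (x * a i) * b i = x.
Proof.
under eq_bigr do rewrite mulr_suml.
rewrite exchange_big (bigD1 1%g) //= [X in _ + X]big1 => [|g g1].
  rewrite addr0 -[RHS]mulr1 -coords_mul1 mulr_sumr.
  by apply: eq_bigr => i _; rewrite galois_act1 mulrA.
under eq_bigr do rewrite rmorphM -mulrA.
by rewrite -mulr_sumr coords_act (negPf g1) mulr0.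
Qed.

(** The inverse sends the Dirac function at g to sum_i a_i (x) g^-1(b_i). That
    it is a left inverse uses the Casimir property to move g(t) to the other
    factor, and then that the traces of the b_i are scalars. *)
Lemma coords_galois_bij : bijective (galois_map act).
Proof.
pose K (v : {ffun G -> S}) : tens (amod S) (amod S) :=
  \sum_g \sum_i tp (v g * a i) (act g^-1%g (b i)).
have KD (v w z : {ffun G -> S}) : (forall g, z g = v g + w g) -> K z = K v + K w.
  move=> zE; rewrite /K -big_split; apply: eq_bigr => g _.
  rewrite -big_split; apply: eq_bigr => i _.
  by rewrite zE mulrDl tpureDl.
exists K => [u|v]; last first.
  apply/ffunP => h.
  rewrite -[LHS]/(linear_of (galois_map_linear h) _) linear_sum /=.
  under eq_bigr do rewrite galois_mapE.
  rewrite (bigD1 h) //= [X in _ + X]big1 => [|g gh].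
    rewrite addr0 -[RHS]mulr1 -coords_mul1 mulr_sumr.
    by apply: eq_bigr => i _; rewrite -galois_actM mulgV galois_act1 mulrA.
  under eq_bigr do rewrite -galois_actM -mulrA.
  by rewrite -mulr_sumr abE -eq_mulgV1 eq_sym (negPf gh) mulr0.
elim/tens_ind: u => [|u v IHu IHv|s t].
- rewrite /K big1 // => g _; rewrite big1 // => i _.
  by rewrite -[_ g]/(linear_of (galois_map_linear g) 0) linear0 mul0r tpure0l.
- rewrite -{2}IHu -{2}IHv; apply: KD => g.
  by rewrite -[LHS]/(linear_of (galois_map_linear g) _) linearD.
have fB g : bilin (fun x y : amod S => tp (s * x) (act g^-1%g y)).
  split=> [y r x x'|x r y y']; first by rewrite mulrDr -amodAr tpureDl tpureZl.
  by rewrite galois_act_linear tpureDr tpureZr.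
(* The Casimir property moves g(t) to the second factor, where g^-1 undoes g.
   *)
have step g : \sum_i tp (galois_map act (s \ox t) g * a i) (act g^-1%g (b i))
    = \sum_i tp (s * a i) (act g^-1%g (b i) * t).
  rewrite galois_map_pure //; have := casimir_bilin ab (act g t) (fB g).
  under eq_bigr do rewrite mulrA; move=> ->.
  by apply: eq_bigr => i _; rewrite rmorphM -galois_actM mulVg galois_act1.
rewrite /K (eq_bigr _ (fun g _ => step g)) exchange_big /=.
transitivity (\sum_i tp (s * (a i * trace (b i * 1))) t).
  apply: eq_bigr => i _; rewrite -tpure_sumr -mulr_suml mulr1.
  have -> : \sum_g act g^-1%g (b i) = trace (b i).
    by rewrite /trace [RHS](reindex_inj invg_inj).
  have [_ _ /(_ (b i))[r ->]] := coords.
  rewrite mulrA -alg_mapC.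
  exact: etrans (tpureZr r _ _) (esym (tpureZl r _ _)).
by rewrite -tpure_suml -mulr_sumr coords_trace mulr1.
Qed.

Hypothesis centralS : central S.

Let injS : injective (fun r : R => alg_map r : S).
Proof. by have [] := centralS. Qed.

(** By coords_trace, the forms dual to the a_i are x |-> tr(b_i x). *)
Lemma coords_dual_basis : exists f : I -> {linear amod S -> R^o},
  dual_basis (a : I -> amod S) f.
Proof.
have [tau tauE] : exists tau : {linear amod S -> R^o},
    forall s, trace s = alg_map (tau s : R).
  by apply: (central_lift centralS trace_linear); have [] := coords.
have fL i : linear (fun x : amod S => tau (b i * x)).
  by move=> r x y; rewrite mulrDr -amodAr linearP.
exists (fun i => linear_of (fL i)) => x.
rewrite -[LHS]coords_trace; apply: eq_bigr => i _.
by rewrite tauE -alg_mapC.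
Qed.

Lemma sandwich1 : sandwich a b 1 = 1.
Proof. by rewrite -[RHS]coords_mul1; apply: eq_bigr => i _; rewrite mulr1. Qed.

Lemma sandwich_retraction : exists rho : {linear amod S -> R^o},
  (forall s, sandwich a b s = alg_map (rho s : R)) /\ rho 1 = 1.
Proof.
have [|rho rhoE] := central_lift centralS (sandwich_linear a b).
  move=> s; have [_] := centralS; apply=> x; exact: sandwich_central.
exists rho; split=> //; apply: injS; rewrite -rhoE sandwich1; exact/esym/rmorph1.
Qed.

Lemma faithful_amod : faithful (amod S).
Proof.
move=> r r0; apply: injS; rewrite rmorph0.
by have := r0 1; rewrite amodZE mulr1.
Qed.

Lemma coords_progenerator : progenerator (amod S).
Proof.
have [f fP] := coords_dual_basis.
exact: dual_basis_progenerator fP faithful_amod.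
Qed.

Lemma coords_galois_azumaya : galois_azumaya act.
Proof.
split; last by split=> //; exact: casimir_separable ab coords_mul1.
split=> //; last exact: coords_galois_bij.
have [f fP] := coords_dual_basis; have [rho [_ rho1]] := sandwich_retraction.
exact: split_faithfully_flat fP rho1.
Qed.

(** The element e is fixed by G acting on both factors, as its image under the
    Galois map shows. So the sandwich map sends g(s) to the image under g of
    the sandwich of s, a scalar, which g fixes. The trace of s is a scalar too,
    hence equal to its own sandwich, which is a sum of |G| equal terms. *)
Lemma trace_sandwich s : trace s = sandwich a b s *+ #|G|.
Proof.
have [rho [rhoE _]] := sandwich_retraction.
have actC g : \sum_i tp (act g (a i)) (act g (b i)) = \sum_i tp (a i) (b i).
  have [K gK _] := coords_galois_bij.
  apply: (can_inj gK); apply/ffunP => h; rewrite !galois_mapE abE.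
  under eq_bigr => i _ do
    rewrite -[act h (act g _)]galois_actM -[(h * g)%g](mulKVg g) galois_actM -rmorphM.
  by rewrite -rmorph_sum abE rmorph_nat -[(_ * _)%g]/(h ^ g)%g conjg_eq1.
have sandwich_act g : sandwich a b (act g s) = sandwich a b s.
  have [h hE] := tlift_is_linear (sandwich_bilin (act g s)).
  have := congr1 h (actC g); rewrite !linear_sum.
  under eq_bigr do rewrite hE -!rmorphM; rewrite -rmorph_sum.
  under [X in _ = X]eq_bigr do rewrite hE.
  by move=> E; rewrite -[LHS]E -[X in act g X]/(sandwich a b s) rhoE galois_act_alg.
have [_ _ /(_ s)[r trE]] := coords.
transitivity (sandwich a b (trace s)).
  rewrite trE /sandwich; under eq_bigr do rewrite -alg_mapC -mulrA.
  by rewrite -mulr_sumr coords_mul1 mulr1.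
rewrite -[LHS]/(linear_of (sandwich_linear a b) _) linear_sum /=.
by under eq_bigr do rewrite sandwich_act; rewrite sumr_const.
Qed.

End Coordinates.
End GaloisCoordinates.

(** * The enveloping algebra of a Galois-Azumaya extension *)

Section Enveloping.
Variables (R : comPzRingType) (S : ralgType R) (G : finGroupType).
Variable act : G -> {rmorphism S -> S}.
Variables (I : finType) (a b : I -> S).
Hypotheses (actP : galois_action act) (coords : galois_coords act a b).
Hypothesis centralS : central S.

(** The inverse K comes from the expansion phi(x) = sum_j phi(a_j) tr(b_j x),
    where the trace is rewritten with trace_sandwich; K is a left inverse
    because sum_i tr(t a_i) b_i = t. *)
Lemma coords_enveloping_endo : alg_iso (atens S S^c) (endo (amod S)).
Proof.
have lL s : linear (fun x : amod S => s * x : amod S).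
  by move=> r x y; rewrite mulrDr -amodAr.
have rL s : linear (fun x : amod S => x * s : amod S).
  by move=> r x y; rewrite mulrDl -amodAl.
pose l (s : S) : endo (amod S) := linear_of (lL s).
pose r (t : S^c) : endo (amod S) := linear_of (rL t).
have lB : zmod_morphism l by move=> s t; apply: endoP => x; exact: mulrBl.
have rB : zmod_morphism r by move=> s t; apply: endoP => x; exact: mulrBr.
have lM : monoid_morphism l.
  split=> [|s t]; apply: endoP => x; first exact: mul1r.
  exact/esym/mulrA.
have rM : monoid_morphism r.
  split=> [|s t]; apply: endoP => x; first exact: mulr1.
  exact: (@mulrA S).
have lR : alg_hom (rmorph_of lB lM) by move=> c; apply: endoP.
have rR : alg_hom (rmorph_of rB rM).
  by move=> c; apply: endoP => x; exact/esym/alg_mapC.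
have [|h [hR hE]] := atens_hom lR rR.
  by move=> s t; apply: endoP => x; exact: mulrA.
exists h; split=> //.
have {}hE s t x : h ((s : amod S) \ox (t : amod S^c)) x = s * (x * (t : S)).
  by rewrite hE.
have ab : casimir a b by case: coords.
pose K (phi : endo (amod S)) : tens (amod S) (amod S^c) :=
  \sum_i @tpure R (amod S) (amod S^c)
    (\sum_j phi (a j) * a i * b j *+ #|G|) (b i).
have KD phi psi : K (phi + psi) = K phi + K psi.
  rewrite /K -big_split; apply: eq_bigr => i _.
  rewrite -[RHS]tpureDl -big_split; congr tpure; apply: eq_bigr => j _.
  by rewrite !mulrDl mulrnDl.
have K0 : K 0 = 0 by apply: (addrI (K 0)); rewrite -KD !addr0.
have trE s : trace act s = \sum_j a j * s * b j *+ #|G|.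
  by rewrite (trace_sandwich actP coords centralS) -sumrMnl.
have trC s : exists c : R, trace act s = alg_map c by case: coords.
exists K => [u|phi]; last first.
  have phi_trace y s : phi (y * trace act s) = phi y * trace act s.
    have [c ->] := trC s; rewrite -!alg_mapC.
    exact: (linearZ_LR phi c (y : amod S)).
  apply: endoP => x; rewrite /K rmorph_sum endo_sumE.
  under eq_bigr do rewrite hE mulr_suml.
  rewrite exchange_big -[x in RHS](coords_trace actP coords) linear_sum.
  apply: eq_bigr => j _; rewrite phi_trace trE mulr_sumr.
  by apply: eq_bigr => i _; rewrite mulrnAl mulrnAr !mulrA.
elim/tens_ind: u => [|u v IHu IHv|s t].
- by rewrite rmorph0 K0.
- by rewrite (_ : h (u + v) = h u + h v) ?KD ?IHu ?IHv //; exact: rmorphD.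
transitivity (\sum_i @tpure R (amod S) (amod S^c) s
    (trace act ((t : S) * a i) * b i)); last first.
  by rewrite -tpure_sumr (trace_coords actP coords).
apply: eq_bigr => i _.
have -> : \sum_j h (s \ox t) (a j) * a i * b j *+ #|G|
    = s * trace act ((t : S) * a i).
  rewrite trE mulr_sumr; apply: eq_bigr => j _.
  by rewrite hE mulrnAr !mulrA.
have [c ->] := trC ((t : S) * a i); rewrite -alg_mapC.
have tZ := tpureZr c (s : amod S) (b i : amod S^c).
rewrite -tpureZl in tZ; rewrite -[LHS]tZ; congr tpure.
exact: (esym (@alg_mapC R S c (b i))).
Qed.
End Enveloping.

(** * Opposite algebras, the base ring and tensor products *)

Section Opposite.
Variables (R : comPzRingType) (S : ralgType R) (G : finGroupType).
Variable act : G -> {rmorphism S -> S}.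

Definition opposite_act (g : G) : {rmorphism S^c -> S^c} :=
  @rmorph_of S^c S^c (act g) (@rmorphB S S (act g))
    (conj (@rmorph1 S S (act g)) (fun x y => @rmorphM S S (act g) y x)).

Lemma opposite_action : galois_action act -> galois_action opposite_act.
Proof. by []. Qed.

(** The opposite product reverses sum_i g(a_i) b_i, and the Casimir equation is
    the one of S read with the two tensor factors exchanged. *)
Lemma opposite_coords (I : finType) (a b : I -> S) :
    galois_action act -> galois_coords act a b ->
  galois_coords opposite_act (b : I -> S^c) (a : I -> S^c).
Proof.
move=> actP coords; have [abE ab trR] := coords; split=> //.
  by move=> g; exact: (coords_act actP coords).
move=> x.
have swapB : bilin (fun s t : amod S => @tpure R (amod S^c) (amod S^c) t s).
  split=> [y r s s'|s r t t'].
    rewrite tpureDr -tpureZr; congr (_ \ox _ + _).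
    exact: (alg_mapC r (s : S)).
  rewrite tpureDl -tpureZl; congr (_ \ox _ + _).
  exact: (alg_mapC r (t : S)).
exact: esym (casimir_bilin ab x swapB).
Qed.

Lemma opposite_central : central S -> central (S^c : ralgType R).
Proof.
move=> [injS centS]; split; first exact: injS.
by move=> z zC; apply: centS => s; exact/esym/zC.
Qed.
End Opposite.

Section Regular.
Variable R : comPzRingType.

Definition regular_act (_ : 'I_1) : {rmorphism R^o -> R^o} := idfun.

Lemma regular_action : galois_action (S := R^o) regular_act.
Proof. by []. Qed.

Lemma regular_coords :
  galois_coords (S := R^o) regular_act (fun _ : unit => 1) (fun _ => 1).
Proof.
split.
- by move=> g; rewrite big_const card_unit /= addr0 mulr1 ord1.
- move=> x; rewrite !big_const card_unit /= !addr0 mul1r.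
  rewrite -[x in RHS]mulr1; apply: esym.
  exact: etrans (@tpureZr R (amod R^o) (amod R^o) x 1 1)
    (esym (@tpureZl R (amod R^o) (amod R^o) x 1 1)).
- by move=> s; exists s; rewrite /trace big_const card_ord /= addr0.
Qed.

Lemma regular_central : central (R^o : ralgType R).
Proof. by split=> // z _; exists z. Qed.

Lemma regular_galois_azumaya : galois_azumaya (S := R^o) regular_act.
Proof.
exact: (coords_galois_azumaya regular_action regular_coords regular_central).
Qed.
End Regular.

Section TensorGalois.
Variables (R : comPzRingType) (S T : ralgType R) (G H : finGroupType).
Variables (actS : G -> {rmorphism S -> S}) (actT : H -> {rmorphism T -> T}).
Hypotheses (actSP : galois_action actS) (actTP : galois_action actT).
Variables (I J : finType) (a b : I -> S) (c d : J -> T).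
Hypotheses (abP : galois_coords actS a b) (cdP : galois_coords actT c d).
Local Notation tp := (@tpure R (amod S) (amod T)).

Lemma tens_act : exists act : G * H -> {rmorphism atens S T -> atens S T},
  forall gh s t, act gh (tp s t) = tp (actS gh.1 s) (actT gh.2 t).
Proof.
have [_ _ actSR] := actSP; have [_ _ actTR] := actTP.
have actP (gh : G * H) : exists f : {rmorphism atens S T -> atens S T},
    forall s t, f (tp s t) = tp (actS gh.1 s) (actT gh.2 t).
  by have [f [_ fE]] := atens_map (actSR gh.1) (actTR gh.2); exists f.
by have [act actE] := choice actP; exists act.
Qed.

Variable act : G * H -> {rmorphism atens S T -> atens S T}.
Hypothesis actE : forall gh s t, act gh (tp s t) = tp (actS gh.1 s) (actT gh.2 t).

Lemma tens_action : galois_action act.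
Proof.
have [S1 SM SR] := actSP; have [T1 TM TR] := actTP.
have addC gh u v : act gh (u + v) = act gh u + act gh v by exact: rmorphD.
split=> [u|g h u|g r].
- elim/tens_ind: u => [|u v IHu IHv|s t]; first exact: rmorph0.
    by rewrite addC IHu IHv.
  by rewrite actE S1 T1.
- elim/tens_ind: u => [|u v IHu IHv|s t]; first by rewrite !rmorph0.
    by rewrite !addC IHu IHv.
  by rewrite !actE SM TM.
- by rewrite !atens_alg_map actE SR rmorph1.
Qed.

Let a' (k : I * J) : atens S T := tp (a k.1) (c k.2).
Let b' (k : I * J) : atens S T := tp (b k.1) (d k.2).

Lemma tens_scalar (r r' : R) : 
  tp (alg_map r) (alg_map r') = alg_map (r * r') :> atens S T.
Proof.
have := tpureZr r' (alg_map r : amod S) (1 : amod T).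
by rewrite amodZE mulr1 -atens_alg_map -atensZE mulrC rmorphM.
Qed.

Lemma tpure_pair_sum (K L : finType) (x : K -> S) (y : L -> T) :
  \sum_(k : K * L) tp (x k.1) (y k.2) = tp (\sum_i x i) (\sum_j y j).
Proof.
rewrite tpure_suml -(pair_bigA _ (fun i j => tp (x i) (y j))).
by apply: eq_bigr => i _; rewrite tpure_sumr.
Qed.

(** By additivity it suffices to move a pure tensor s (x) t across; s and t are
    moved one after the other by the Casimir properties of the factors. *)
Lemma tens_casimir : casimir a' b'.
Proof.
have [[_ ab _] [_ cd _]] := (abP, cdP).
pose tp2 := @tpure R (amod (atens S T)) (amod (atens S T)).
have casD (u v : atens S T) :
    \sum_k tp2 (u * a' k) (b' k) = \sum_k tp2 (a' k) (b' k * u) ->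
    \sum_k tp2 (v * a' k) (b' k) = \sum_k tp2 (a' k) (b' k * v) ->
  \sum_k tp2 ((u + v) * a' k) (b' k) = \sum_k tp2 (a' k) (b' k * (u + v)).
  move=> uE vE; under eq_bigr do rewrite mulrDl /tp2 tpureDl.
  under [RHS]eq_bigr do rewrite mulrDr /tp2 tpureDr.
  by rewrite !big_split -!/tp2 uE vE.
move=> u; elim/tens_ind: u => [|u v IHu IHv|s t]; last 1 first.
have tpZl r x y : tp (r *: x) y = r *: (tp x y : amod (atens S T)).
  by rewrite tpureZl amodZE atensZE.
have tpZr r x y : tp x (r *: y) = r *: (tp x y : amod (atens S T)).
  by rewrite tpureZr amodZE atensZE.
have fB x' y' : bilin (fun x y : amod S => tp2 (tp x x') (tp y y')).
  split=> [y r x1 x2|x r y1 y2]; first by rewrite tpureDl tpZl /tp2 tpureDl tpureZl.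
  by rewrite tpureDl tpZl /tp2 tpureDr tpureZr.
have gB x' y' : bilin (fun x y : amod T => tp2 (tp x' x) (tp y' y)).
  split=> [y r x1 x2|x r y1 y2]; first by rewrite tpureDr tpZr /tp2 tpureDl tpureZl.
  by rewrite tpureDr tpZr /tp2 tpureDr tpureZr.
transitivity (\sum_i \sum_j tp2 (tp (s * a i) (t * c j)) (tp (b i) (d j))).
  by rewrite pair_big; apply: eq_bigr => k _; rewrite tpureM.
under eq_bigr do rewrite (casimir_bilin cd t (gB _ _)).
rewrite exchange_big.
under eq_bigr do rewrite (casimir_bilin ab s (fB _ _)).
rewrite exchange_big pair_big; apply: eq_bigr => k _.
by rewrite [b' k * _]tpureM.
- rewrite !big1 // => k _; first by rewrite mulr0 tpure0r.
  by rewrite mul0r tpure0l.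
- exact: casD IHu IHv.
Qed.

Lemma tens_coords : galois_coords act a' b'.
Proof.
have [[abE _ trS] [cdE _ trT]] := (abP, cdP).
split; [move=> [g h] | exact: tens_casimir | ].
  transitivity (tp (\sum_i a i * actS g (b i)) (\sum_j c j * actT h (d j))).
    rewrite -tpure_pair_sum; apply: eq_bigr => k _.
    by rewrite actE tpureM.
  rewrite abE cdE.
  have -> : ((g, h) == 1%g) = (g == 1%g) && (h == 1%g) by [].
  case: eqP => _; last by rewrite tpure0l.
  by case: eqP => _; last by rewrite tpure0r.
elim/tens_ind=> [|u v [r uE] [r' vE]|s t].
- by exists 0; rewrite /trace big1 ?rmorph0 // => gh _; rewrite rmorph0.
- exists (r + r'); rewrite rmorphD -uE -vE /trace -big_split.
  by apply: eq_bigr => gh _; exact: rmorphD.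
- have [[r rE] [r' r'E]] := (trS s, trT t); exists (r * r').
  rewrite -tens_scalar -rE -r'E -tpure_pair_sum.
  by apply: eq_bigr => gh _; rewrite actE.
Qed.

(** A central element is its own sandwich, and the sandwich map of S (x) T is
    the tensor product of those of S and T, whose values are scalars. *)
Lemma tens_central : central S -> central T -> central (atens S T).
Proof.
move=> centS centT.
have [rho [rhoE rho1]] := sandwich_retraction actSP abP centS.
have [sig [sigE sig1]] := sandwich_retraction actTP cdP centT.
split.
  apply: (can_inj (g := fun u => tform rho sig u : R)) => r.
  have := tformE rho sig (alg_map r : amod S) 1.
  rewrite -atens_alg_map => ->; rewrite sig1 mulr1.
  have := linearZ_LR rho r (1 : amod S).
  by rewrite amodZE mulr1 rho1 => ->; exact: mulr1.
have sandE u : exists r : R, sandwich a' b' u = alg_map r.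
  elim/tens_ind: u => [|u v [r uE] [r' vE]|s t].
  - by exists 0; rewrite rmorph0 /sandwich big1 // => k _; rewrite mulr0 mul0r.
  - exists (r + r'); rewrite rmorphD -uE -vE /sandwich -big_split.
    by apply: eq_bigr => k _; rewrite mulrDr mulrDl.
  - exists (rho s * sig t); rewrite -tens_scalar -rhoE -sigE -tpure_pair_sum.
    by apply: eq_bigr => k _; rewrite !tpureM.
move=> z zC; have [r rE] := sandE z; exists r; rewrite -rE.
rewrite -[LHS]mulr1 -(coords_mul1 tens_action tens_coords) mulr_sumr.
by apply: eq_bigr => k _; rewrite mulrA zC.
Qed.
End TensorGalois.

(** * The subgroup of Galois classes *)

Section BrauerGalois.
Variable R : comPzRingType.
Implicit Types S T : ralgType R.

Lemma BrGal_class S (G : finGroupType) (act : G -> {rmorphism S -> S}) :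
  galois_azumaya act -> BrGal (brauer_class S).
Proof.
move=> gal; split; last by exists G, S, act.
by exists S; split=> //; case: gal.
Qed.

Lemma galois_azumaya_coords S (G : finGroupType) (act : G -> {rmorphism S -> S}) :
    galois_azumaya act ->
  exists (I : finType) (a b : I -> S), galois_coords act a b.
Proof.
by move=> [[actP _ bij] [centS _]]; exact: galois_extension_coords actP centS bij.
Qed.

Lemma br_subgroup_BrGal : br_subgroup (@BrGal R).
Proof.
split.
- by move=> xi [].
- exact: BrGal_class (regular_galois_azumaya R).
- move=> xi eta [_ [G [S [actS [galS ->]]]]] [_ [H [T [actT [galT ->]]]]].
  have [[[actSP _ _] azS] [[actTP _ _] azT]] := (galS, galT).
  have [[I [a [b abP]]] [J [c [d cdP]]]] :=
    (galois_azumaya_coords galS, galois_azumaya_coords galT).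
  rewrite br_mul_class //.
  have [act actE] := tens_act actSP actTP.
  have [[centS _] [centT _]] := (azS, azT).
  refine (BrGal_class (coords_galois_azumaya (tens_action actSP actTP actE)
    (tens_coords abP cdP actE)
    (tens_central actSP actTP abP cdP actE centS centT))).
- move=> xi [_ [G [S [act [gal ->]]]]].
  have [[actP _ _] azS] := gal; have [centS _] := azS.
  have [I [a [b abP]]] := galois_azumaya_coords gal.
  have galC : galois_azumaya (opposite_act act).
    exact: (coords_galois_azumaya (opposite_action actP)
      (opposite_coords actP abP) (opposite_central centS)).
  have [_ azSc] := galC.
  have iso := coords_enveloping_endo actP abP centS.
  have Sg := coords_progenerator actP abP centS.
  exists (brauer_class (S^c : ralgType R)); split; first exact: BrGal_class galC.
    by rewrite br_mul_class //; exact: alg_iso_endo_br_one Sg iso.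
  rewrite br_mul_class //; apply: alg_iso_endo_br_one Sg _.
  exact: alg_iso_trans (alg_iso_tensC _ _) iso.
Qed.
End BrauerGalois.

Theorem corollary3p3 (k : comPzRingType) (R : comRalgType k) :
  br_subgroup (@BrGal R).
Proof. exact: br_subgroup_BrGal. Qed.
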